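(* Assume that for all integers $0\le M,N\le 2s$ there exist a non-trivial admissible solution $S_-^{M(h)}=\{v_1,\dots,v_M\}$ of $E_-^M(v_i,\bar v_i)=0$ ($i=1,\dots,M$) and a non-trivial admissible solution $S_+^{*N(h)}=\{y_1,\dots,y_N\}$ of $E_+^N(y_i,\bar y_i)=0$ ($i=1,\dots,N$). Then for all $0\le M,N\le 2s$: $$\langle\theta_M|=\tilde{\mathcal N}_M(\bar v)\,\langle\Psi_-^M(\bar v,m_0)|\quad\text{for }\bar v=S_-^{M(h)},\qquad \langle\theta^*_N|=\tilde{\mathcal N}^*_N(\bar y)\,\langle\Psi_+^N(\bar y,m_0)|\quad\text{for }\bar y=S_+^{*N(h)},$$ with $$\tilde{\mathcal N}_M(\bar v)=\prod_{k=1}^M\big(q^{-1}v_k\,b(v_k^2)\tilde A^*_{k-1,k}\big)^{-1},\qquad \tilde{\mathcal N}^*_N(\bar y)=\prod_{k=1}^N\big(-q\,y_k^{-1}b(y_k^2)\tilde A_{k-1,k}\big)^{-1},$$ and $\tilde{\mathcal N}_0=\tilde{\mathcal N}_0^*=1$.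
   Context: **Setting.** $q\in\mathbb C^*$ is not a root of unity; $[X,Y]_q=qXY-q^{-1}YX$; $b(x)=x-x^{-1}$. $s\ge 0$ is an integer or half-integer. $\mathsf b,\mathsf c,\mathsf b^*,\mathsf c^*,\zeta\in\mathbb C^*$ are generic subject to $\mathsf b\mathsf c=\mathsf b^*\mathsf c^*$ (in particular all quantities below are well defined). Put $\theta_M=\mathsf b q^{2M}+\mathsf c q^{-2M}$, $\theta^*_N=\mathsf b^*q^{2N}+\mathsf c^*q^{-2N}$, $\rho=-\mathsf b\mathsf c(q^2-q^{-2})^2$, $\omega=(q-q^{-1})^2\big(\mathsf b\mathsf c(\zeta^2+\zeta^{-2})(q^{2s+1}+q^{-2s-1})-(\mathsf b q^{2s}+\mathsf c q^{-2s})(\mathsf b^*q^{2s}+\mathsf c^*q^{-2s})\big)$, $\eta=-\frac{(q^2-q^{-2})^2}{q+q^{-1}}\mathsf b\mathsf c\big((\mathsf b q^{2s}+\mathsf c q^{-2s})(\zeta^2+\zeta^{-2})-(\mathsf b^*q^{2s}+\mathsf c^*q^{-2s})(q^{2s+1}+q^{-2s-1})\big)$, and $\eta^*$ is obtained from $\eta$ by exchanging $(\mathsf b,\mathsf c)\leftrightarrow(\mathsf b^*,\mathsf c^* )$. $\mathcal V$ is a complex vector space of dimension $2s+1$, and $A,A^*\in\mathrm{End}(\mathcal V)$ (the images $\pi(\mathsf A),\pi(\mathsf A^* )$ of the generators of the Askey-Wilson algebra) are diagonalizable, multiplicity-free, act irreducibly on $\mathcal V$, have eigenvalues $\{\theta_M\}_{M=0}^{2s}$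 and $\{\theta^*_N\}_{N=0}^{2s}$ respectively, and satisfy the Askey-Wilson relations $[A,[A,A^*]_q]_{q^{-1}}=\rho A^*+\omega A+\eta I$, $[A^*,[A^*,A]_q]_{q^{-1}}=\rho A+\omega A^*+\eta^*I$. They form a Leonard pair: there are eigenbases $A|\theta_M\rangle=\theta_M|\theta_M\rangle$, $A^*|\theta^*_N\rangle=\theta^*_N|\theta^*_N\rangle$ ($0\le M,N\le 2s$) with $A^*|\theta_M\rangle=A^*_{M+1,M}|\theta_{M+1}\rangle+A^*_{M,M}|\theta_M\rangle+A^*_{M-1,M}|\theta_{M-1}\rangle$ and $A|\theta^*_N\rangle=A_{N+1,N}|\theta^*_{N+1}\rangle+A_{N,N}|\theta^*_N\rangle+A_{N-1,N}|\theta^*_{N-1}\rangle$, normalized so that $|\theta^*_0\rangle=\sum_M|\theta_M\rangle$ and $$A^*_{M,M-1}=q^{2-4s}\frac{(1-q^{2M})(\mathsf c-\mathsf b q^{2M+4s})(\mathsf b^*q^{2s-1}\zeta^{-2}+\mathsf b q^{2M-2})(\mathsf c q^{2s-1}\zeta^2+\mathsf c^*q^{2M-2})}{(\mathsf c-\mathsf b q^{4M-2})(\mathsf c-\mathsf b q^{4M})},$$ $$A^*_{M-1,M}=\frac{(1-q^{2M-4s-2})(\mathsf c-\mathsf b q^{2M-2})(\mathsf c+\mathsf b^*\zeta^{-2}q^{2M+2s-1})(\mathsf c^*+\mathsf b\zeta^2q^{2M+2s-1})}{(\mathsf c-\mathsf b q^{4M-4})(\mathsf c-\mathsf b q^{4M-2})},$$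 $A^*_{M,M}=\theta^*_0-A^*_{M,M+1}-A^*_{M,M-1}$, the coefficients $A_{N,N'}$ being obtained by $(\mathsf b,\mathsf c,\zeta,M)\leftrightarrow(\mathsf b^*,\mathsf c^*,\zeta^{-1},N)$. $\tilde{\mathcal V}$ is the dual space, $\langle\cdot|\cdot\rangle$ the pairing $\tilde{\mathcal V}\times\mathcal V\to\mathbb C$; $\langle\theta_M|,\langle\theta^*_N|\in\tilde{\mathcal V}$ are nonzero left eigenvectors, $\langle\theta_M|A=\theta_M\langle\theta_M|$, $\langle\theta^*_N|A^*=\theta^*_N\langle\theta^*_N|$, with arbitrary fixed normalizations $\langle\theta_{M'}|\theta_M\rangle=\delta_{MM'}\xi_M$, $\langle\theta^*_{N'}|\theta^*_N\rangle=\delta_{NN'}\xi^*_N$, $\xi_M,\xi^*_N\neq0$. Then $\langle\theta_M|A^*=\sum_{M'}\tilde A^*_{M,M'}\langle\theta_{M'}|$ and $\langle\theta^*_N|A=\sum_{N'}\tilde A_{N,N'}\langle\theta^*_{N'}|$ (sums over $M'\in\{M,M\pm1\}$, $N'\in\{N,N\pm1\}$) with $\tilde A^*_{M,M'}=A^*_{M,M'}\xi_M/\xi_{M'}$, $\tilde A_{N,N'}=A_{N,N'}\xi^*_N/\xi^*_{N'}$. The dual reference states are $\langle\Omega^-|=\langle\theta_0|$, $\langle\Omega^+|=\langle\theta^*_0|$. **Dual Bethe states.** Fix $\chi\in\mathbb C^*$ and an integer $m_0$. Put $$\mathcal B(u)=\chi\,b(u^2)\Big(\rho^{-1}\big([A^*,A]_q+\tfrac{\omega}{q-q^{-1}}I\big)+\tfrac{qu^2+q^{-1}u^{-2}}{q^2-q^{-2}}I\Big).$$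 - $\langle\Psi_-^M(\bar v,m_0)|=\langle\Omega^-|\mathscr C^-(v_1,m_0+2)\cdots\mathscr C^-(v_M,m_0+2M)$, where $\mathscr C^-(v,m)=\beta^{-1}q^{2-m}v\,\mathcal B(v)$ with $(q^2-q^{-2})\chi^{-1}\beta\,\mathsf c\,q^{m_0-2}=-1$. - $\langle\Psi_+^N(\bar y,m_0)|=\langle\Omega^+|\mathscr C^+(y_1,m_0+2)\cdots\mathscr C^+(y_N,m_0+2N)$, where $\mathscr C^+(v,m)=\beta^{-1}q^{m-2}v^{-1}\mathcal B(v)$ with $(q^2-q^{-2})\chi^{-1}\beta\,\mathsf b^*q^{-m_0+2}=1$. **Homogeneous Bethe equations.** $f(u,v)=\frac{b(qv/u)b(uv)}{b(v/u)b(quv)}$, $h(u,v)=\frac{b(q^2uv)b(qu/v)}{b(quv)b(u/v)}$. For $\epsilon=\pm1$, $$\Lambda_1^\epsilon(u)=\tfrac{q^{-2s-1}}{u^\epsilon}(q^{2s+1}u\zeta^{-1}-u^{-1}\zeta)(q^{2s+1}u\zeta-u^{-1}\zeta^{-1})(u\mathsf c^*q^{-2s}+u^{-1}\mathsf b q^{2s})\Big(u(\tfrac{\mathsf c}{\mathsf c^*})^{\frac{1-\epsilon}2}+u^{-1}(\tfrac{\mathsf b^*}{\mathsf b})^{\frac{1+\epsilon}2}\Big),$$ $$\Lambda_2^\epsilon(u)=\tfrac{(u^2-u^{-2})q^{-2s-1}}{u^\epsilon(qu^2-q^{-1}u^{-2})}(q^{2s-1}u^{-1}\zeta-u\zeta^{-1})(q^{2s-1}u^{-1}\zeta^{-1}-u\zeta)(q^2u\mathsf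 b q^{2s}+u^{-1}\mathsf c^*q^{-2s})\Big(q^2u(\tfrac{\mathsf b^*}{\mathsf b})^{\frac{1+\epsilon}2}+u^{-1}(\tfrac{\mathsf c}{\mathsf c^*})^{\frac{1-\epsilon}2}\Big),$$ $$E_\pm^M(u_i,\bar u_i)=-\frac{b(u_i^2)}{b(qu_i^2)}\prod_{j\ne i}f(u_i,u_j)\Lambda_1^\pm(u_i)+\prod_{j\neq i}h(u_i,u_j)\Lambda_2^\pm(u_i),\quad 1\le i,j\le M.$$ A solution is *non-trivial* if $u_i\ne0$ and $u_i^2\neq u_i^{-2}$ for all $i$, and *admissible* if $U_i\ne U_j$ for $i\neq j$, where $U_i=(qu_i^2+q^{-1}u_i^{-2})/(q+q^{-1})$; the equations are understood where defined ($b(qu_i^2)\ne0$). *)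

(* Defs.v *)
From HB Require Import structures.
From mathcomp Require Export all_boot all_order all_algebra.
From mathcomp Require Export reals complex.

Set Implicit Arguments.
Unset Strict Implicit.
Unset Printing Implicit Defensive.

Import GRing.Theory.
Local Open Scope ring_scope.

(* Throughout, [d : nat] stands for 2s, so that s ranges over the nonnegative
   integers and half-integers and every power of q below is an integer power.
   Quantities attached to A* are functions of (b, c, b*, c*, zeta), written
   [b c bs cs z]; the ones attached to A are obtained by instantiating the same
   functions at [bs cs b c z^-1]. *)

Section Scalars.
Variable F : fieldType.
Implicit Types (q b c bs cs z u v : F) (d M : nat).

Definition bfun (x : F) : F := x - x^-1.

Definition theta q b c M : F :=
  b * q ^ (2 * M%:Z) + c * q ^ (- (2 * M%:Z)).

Definition aw_rho q b c : F := - (b * c) * (q ^+ 2 - q ^- 2) ^+ 2.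

Definition aw_omega q d b c bs cs z : F :=
  (q - q^-1) ^+ 2 *
  (b * c * (z ^+ 2 + z ^- 2) * (q ^ (d%:Z + 1) + q ^ (- d%:Z - 1))
   - (b * q ^ d%:Z + c * q ^ (- d%:Z)) * (bs * q ^ d%:Z + cs * q ^ (- d%:Z))).

Definition aw_eta q d b c bs cs z : F :=
  - ((q ^+ 2 - q ^- 2) ^+ 2 / (q + q^-1)) * (b * c) *
  ((b * q ^ d%:Z + c * q ^ (- d%:Z)) * (z ^+ 2 + z ^- 2)
   - (bs * q ^ d%:Z + cs * q ^ (- d%:Z)) * (q ^ (d%:Z + 1) + q ^ (- d%:Z - 1))).

(* A*_{M,M-1} *)
Definition sub_coef q d b c bs cs z M : F :=
  q ^ (2 - 2 * d%:Z) *
  ((1 - q ^ (2 * M%:Z)) * (c - b * q ^ (2 * M%:Z + 2 * d%:Z))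
   * (bs * q ^ (d%:Z - 1) * z ^- 2 + b * q ^ (2 * M%:Z - 2))
   * (c * q ^ (d%:Z - 1) * z ^+ 2 + cs * q ^ (2 * M%:Z - 2)))
  / ((c - b * q ^ (4 * M%:Z - 2)) * (c - b * q ^ (4 * M%:Z))).

(* A*_{M-1,M} *)
Definition super_coef q d b c bs cs z M : F :=
  ((1 - q ^ (2 * M%:Z - 2 * d%:Z - 2)) * (c - b * q ^ (2 * M%:Z - 2))
   * (c + bs * z ^- 2 * q ^ (2 * M%:Z + d%:Z - 1))
   * (cs + b * z ^+ 2 * q ^ (2 * M%:Z + d%:Z - 1)))
  / ((c - b * q ^ (4 * M%:Z - 4)) * (c - b * q ^ (4 * M%:Z - 2))).

(* A*_{M',M}.  The out-of-range terms A*_{0,-1} and A*_{2s,2s+1} of the diagonal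
   coefficients vanish through the factors 1 - q^0 of the two formulas above. *)
Definition leonard_coef q d b c bs cs z (M' M : nat) : F :=
  if M' == M.+1 then sub_coef q d b c bs cs z M'
  else if M == M'.+1 then super_coef q d b c bs cs z M
  else if M' == M then
    theta q bs cs 0 - super_coef q d b c bs cs z M.+1
                    - sub_coef q d b c bs cs z M
  else 0.

(* Genericity: exactly the nonvanishing of the denominators of A*_{M,M-1} and
   A*_{M-1,M} for 1 <= M <= 2s. *)
Definition coef_defined q d b c : Prop :=
  forall M, (0 < M <= d)%N ->
    [/\ c - b * q ^ (4 * M%:Z - 4) != 0,
        c - b * q ^ (4 * M%:Z - 2) != 0
      & c - b * q ^ (4 * M%:Z) != 0].

Definition ffun_f q u v : F :=
  (bfun (q * v / u) * bfun (u * v)) / (bfun (v / u) * bfun (q * u * v)).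

Definition ffun_h q u v : F :=
  (bfun (q ^+ 2 * u * v) * bfun (q * u / v)) / (bfun (q * u * v) * bfun (u / v)).

(* [eps] is only used at the values 1 and -1 *)
Definition Lambda1 q d b c bs cs z (eps : int) u : F :=
  q ^ (- d%:Z - 1) / u ^ eps
  * (q ^ (d%:Z + 1) * u * z^-1 - u^-1 * z)
  * (q ^ (d%:Z + 1) * u * z - u^-1 * z^-1)
  * (u * cs * q ^ (- d%:Z) + u^-1 * b * q ^ d%:Z)
  * (u * (c / cs) ^ ((1 - eps) %/ 2)%Z + u^-1 * (bs / b) ^ ((1 + eps) %/ 2)%Z).

Definition Lambda2 q d b c bs cs z (eps : int) u : F :=
  (u ^+ 2 - u ^- 2) * q ^ (- d%:Z - 1)
    / (u ^ eps * (q * u ^+ 2 - q^-1 * u ^- 2))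
  * (q ^ (d%:Z - 1) * u^-1 * z - u * z^-1)
  * (q ^ (d%:Z - 1) * u^-1 * z^-1 - u * z)
  * (q ^+ 2 * u * b * q ^ d%:Z + u^-1 * cs * q ^ (- d%:Z))
  * (q ^+ 2 * u * (bs / b) ^ ((1 + eps) %/ 2)%Z
     + u^-1 * (c / cs) ^ ((1 - eps) %/ 2)%Z).

Definition bethe_E q d b c bs cs z (eps : int) M (u : 'I_M -> F) (i : 'I_M) : F :=
  - (bfun (u i ^+ 2) / bfun (q * u i ^+ 2))
    * (\prod_(j < M | j != i) ffun_f q (u i) (u j))
    * Lambda1 q d b c bs cs z eps (u i)
  + (\prod_(j < M | j != i) ffun_h q (u i) (u j))
    * Lambda2 q d b c bs cs z eps (u i).

Definition bethe_nontrivial M (u : 'I_M -> F) : Prop :=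
  forall i, u i != 0 /\ u i ^+ 2 != u i ^- 2.

Definition bethe_U q u : F := (q * u ^+ 2 + q^-1 * u ^- 2) / (q + q^-1).

Definition bethe_admissible q M (u : 'I_M -> F) : Prop :=
  forall i j, i != j -> bethe_U q (u i) != bethe_U q (u j).

(* The last nonvanishing condition makes the equations meaningful: it is their
   only denominator that admissibility does not already keep away from 0. *)
Definition bethe_solution q d b c bs cs z (eps : int) M (u : 'I_M -> F) : Prop :=
  [/\ bethe_nontrivial u, bethe_admissible q u,
      forall i, bfun (q * u i ^+ 2) != 0
    & forall i, bethe_E q d b c bs cs z eps u i = 0].

End Scalars.

Section Operators.
Variables (F : fieldType) (V : vectType F).
Implicit Types (q b c bs cs z u v beta chi : F) (d M : nat) (X Y A As : 'End(V)).

Definition qcomm q X Y : 'End(V) := q *: (X \o Y)%VF - q^-1 *: (Y \o X)%VF.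

Definition irreducible_action X Y : Prop :=
  forall W : {vspace V}, (X @: W <= W)%VS -> (Y @: W <= W)%VS ->
    W = 0%VS \/ W = fullv.

Definition calB q d b c bs cs z chi A As u : 'End(V) :=
  (chi * bfun (u ^+ 2)) *:
    ((aw_rho q b c)^-1 *:
       (qcomm q As A + (aw_omega q d b c bs cs z / (q - q^-1)) *: \1%VF)
     + ((q * u ^+ 2 + q^-1 * u ^- 2) / (q ^+ 2 - q ^- 2)) *: \1%VF).

Definition calC_minus q beta (B : F -> 'End(V)) v (m : int) : 'End(V) :=
  (beta^-1 * q ^ (2 - m) * v) *: B v.

Definition calC_plus q beta (B : F -> 'End(V)) v (m : int) : 'End(V) :=
  (beta^-1 * q ^ (m - 2) * v^-1) *: B v.

(* Row vectors are linear forms, an operator acting on the right of a form by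
   precomposition: <Omega| C(u_1, m0+2) ... C(u_M, m0+2M), where the factor of
   index k : 'I_M (counted from 0) is C(u_{k+1}, m0 + 2(k+1)). *)
Definition dual_bethe_state (Omega : 'Hom(V, F^o)) (C : F -> int -> 'End(V))
    M (u : 'I_M -> F) (m0 : int) : 'Hom(V, F^o) :=
  foldl (fun psi (k : 'I_M) => (psi \o C (u k) (m0 + 2 * k.+1%:Z))%VF)
        Omega (enum 'I_M).

End Operators.

(* \tilde A_{M,M'} = A_{M,M'} xi_M / xi_{M'} *)
Definition dual_coef (F : fieldType) d (a : nat -> nat -> F)
    (xi : 'I_d.+1 -> F) (M M' : nat) : F :=
  a M M' * xi (inord M) / xi (inord M').

Definition norm_minus (F : fieldType) (q : F) (at_ : nat -> nat -> F)
    M (v : 'I_M -> F) : F :=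
  \prod_(k < M) (q^-1 * v k * bfun (v k ^+ 2) * at_ k k.+1)^-1.

Definition norm_plus (F : fieldType) (q : F) (at_ : nat -> nat -> F)
    N (y : 'I_N -> F) : F :=
  \prod_(k < N) (- q * (y k)^-1 * bfun (y k ^+ 2) * at_ k k.+1)^-1.

(* Main.v *)
(* Up to an affine change of variable, the operators [calB u] are [jouk t - Y]
   with [t = q u^2], [jouk t = t + 1/t] and [Y] an affine function of
   [A*, A]_q; so a dual Bethe state is [<theta_0| p(Y)] where [p] has the roots
   [jouk (q v_i^2)].  Eliminating [A*] from the Askey-Wilson relations gives one
   between [A] and [Y], whence [<theta_0| p(Y) A = <theta_0| (D p)(Y)] for a
   second-order q-difference operator [D] that sends a monic [p] of degree [M]
   to [theta_M p] plus terms of lower degree.  The Bethe equations say that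
   [D p] vanishes at the [M] distinct roots of [p], so [D p = theta_M p] and
   [<theta_0| p(Y)] is proportional to [<theta_M|]; the factor is read off the
   superdiagonal of the tridiagonal matrix of [Y].  The case of [A*] is the same
   with [q] and [q^-1] exchanged, which leaves [Y] unchanged. *)
Require Import Defs.
From mathcomp Require Import all_boot all_order all_algebra.
From mathcomp Require Import reals complex.
From mathcomp Require Import ring zify.

Set Implicit Arguments.
Unset Strict Implicit.
Unset Printing Implicit Defensive.

Import GRing.Theory.
Local Open Scope ring_scope.

(** * Linear maps on polynomials given by the images of the monomials *)

Section PolyLinear.
Variables (F : fieldType) (W : lmodType F).
Implicit Types (p r : {poly F}) (e : nat -> W).

(** The linear map sending ['X^n] to [e n]. It serves for divided differences, for the operator [D]
    and for the row vectors [w Y^n]. *)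
Definition polylin e p : W := \sum_(i < size p) p`_i *: e i.

Lemma polylin_widen e p n :
  (size p <= n)%N -> polylin e p = \sum_(i < n) p`_i *: e i.
Proof.
move=> le_p_n; rewrite /polylin (big_ord_widen _ (fun i => p`_i *: e i) le_p_n).
rewrite big_mkcond /=; apply: eq_bigr => i _; case: ltnP => // le_p_i.
by rewrite nth_default // scale0r.
Qed.

Lemma polylinD e p r : polylin e (p + r) = polylin e p + polylin e r.
Proof.
rewrite !(@polylin_widen e _ (maxn (size p) (size r))) ?leq_maxl ?leq_maxr //.
  rewrite -big_split; apply: eq_bigr => i _; by rewrite coefD scalerDl.
exact: size_polyD.
Qed.

Lemma polylinZ e a p : polylin e (a *: p) = a *: polylin e p.
Proof.
rewrite !(@polylin_widen e _ (size p)) ?size_scale_leq // scaler_sumr.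
by apply: eq_bigr => i _; rewrite coefZ scalerA.
Qed.

Lemma polylin0 e : polylin e 0 = 0.
Proof. by rewrite /polylin size_poly0 big_ord0. Qed.

Lemma polylinB e p r : polylin e (p - r) = polylin e p - polylin e r.
Proof. by rewrite -(scaleN1r r) polylinD polylinZ scaleN1r. Qed.

Lemma polylinC e a : polylin e a%:P = a *: e 0%N.
Proof.
by rewrite (@polylin_widen _ _ 1) ?size_polyC_leq1 // big_ord1 coefC.
Qed.

Lemma polylinMX e p : polylin e (p * 'X) = polylin (fun i => e i.+1) p.
Proof.
rewrite (@polylin_widen _ _ (size p).+1) ?size_polyMleq ?big_ord_recl.
  rewrite coefMX eqxx scale0r add0r; apply: eq_bigr => i _.
  by rewrite coefMX.
apply: leq_trans (size_polyMleq _ _) _; by rewrite size_polyX addn2.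
Qed.

Lemma polylinXn e n : polylin e 'X^n = e n.
Proof.
elim: n e => [|n IHn] e; first by rewrite expr0 -polyC1 polylinC scale1r.
by rewrite exprSr polylinMX IHn.
Qed.

End PolyLinear.

(** * Divided differences *)

Section DividedDifference.
Variable F : fieldType.
Implicit Types (x a : F) (p r : {poly F}).

(** The quotient of ['X^n - x^n] by ['X - x], built without a division. *)
Fixpoint diffquo x n : {poly F} :=
  if n is n'.+1 then 'X^n' + x *: diffquo x n' else 0.

Lemma diffquoE x n : ('X - x%:P) * diffquo x n = 'X^n - (x ^+ n)%:P.
Proof.
elim: n => [|n IHn] /=; first by rewrite mulr0 !expr0 subrr.
rewrite mulrDr -scalerAr IHn -mul_polyC !exprS polyCM; ring.
Qed.

(** By linearity [p] goes to the quotient of [p - p(x)] by ['X - x]. The case [c = 0] strips the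
    factor at [x] from a product of linear factors. *)
Lemma polylin_diffquo x c r :
  polylin (diffquo x) (('X - x%:P) * r + c%:P) = r.
Proof.
have nz : 'X - x%:P != 0 by rewrite polyXsubC_eq0.
apply: (mulfI nz); set p := _ * r + _.
have px : p.[x] = c by rewrite /p hornerD hornerM hornerXsubC hornerC subrr mul0r add0r.
rewrite /polylin mulr_sumr.
under eq_bigr do rewrite -scalerAr diffquoE scalerBr.
rewrite sumrB -poly_def coefK.
suff -> : \sum_(i < size p) p`_i *: (x ^+ i)%:P = c%:P by rewrite /p addrK.
rewrite -px horner_coef rmorph_sum; apply: eq_bigr => i _.
by rewrite -mul_polyC -polyCM.
Qed.

End DividedDifference.


(** * The q-difference operator [D] and its polynomial eigenvectors *)

Section DifferenceOperator.
Variable F : fieldType.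
Implicit Types (q b c Q s sg Z t x : F) (p r : {poly F}).

Definition jouk t : F := t + t^-1.

(* [Lambda1] at [u], up to a power of [u], as a function of [t = q u^2]; the
   corresponding factor of [Lambda2] is the weight at [t^-1]. *)
Definition aw_weight q b c Q s Z t : F :=
  (Q * t - Z + (Q * t)^-1) * (c / (Q * q) * t + s + b * q * Q / t).

Definition aw_lin q b c Q s sg Z : F :=
  - (q - q^-1) ^+ 2 * (sg * Z - s * jouk (q * Q)).

Definition aw_cst q b c Q s sg Z : F :=
  - (q ^+ 2 - q ^- 2) * (q - q^-1) * (s * Z - sg * jouk (q * Q)).

Definition aw_shift q b c Q s Z : F :=
  - (q - q^-1) * (s * (Q - Q^-1) - Z * (c / (Q * q) - b * q * Q)).

(* [aw_poly n] is the image [D 'X^n] of a monomial; the recursion transcribes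
   the Askey-Wilson relation between [A] and [Y], and [aw_poly_diff] is the
   closed form of [D] with divided differences.  The parameters stand for
   [Q = q^(2s)], [s = b* Q + c*/Q], [sg = b Q + c/Q], [Z = zeta^2 + zeta^-2]. *)
Fixpoint aw_poly q b c Q s sg Z n : {poly F} :=
  match n with
  | 0%N => (theta q b c 0)%:P
  | 1%N => theta q b c 1 *: 'X + (aw_shift q b c Q s Z)%:P
  | (m.+1 as k).+1 =>
      (q ^+ 2 + q ^- 2) *: (aw_poly q b c Q s sg Z k * 'X)
      - aw_poly q b c Q s sg Z m * 'X^2
      - (q ^+ 2 - q ^- 2) ^+ 2 *: aw_poly q b c Q s sg Z m
      + aw_lin q b c Q s sg Z *: 'X^(m.+1) + aw_cst q b c Q s sg Z *: 'X^m
  end.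

(** With [K = q^2 - q^-2], the quadratic [T^2 - (q^2 + q^-2) x T + x^2 + K^2] has the roots [a] and
    [jouk (q^-2 t)]. So [a^n] obeys the homogeneous recursion, and [x^n] leaves the defect
    [(x - jouk (q^-2 t)) x^n]. *)
Lemma diffquo_rec q t n (x := jouk t) (a := jouk (q ^+ 2 * t)) :
    q != 0 -> t != 0 ->
  (diffquo x n.+2).[a] = (q ^+ 2 + q ^- 2) * x * (diffquo x n.+1).[a]
    - (x ^+ 2 + (q ^+ 2 - q ^- 2) ^+ 2) * (diffquo x n).[a]
    + (q - q^-1) * (t / q - q / t) * x ^+ n.
Proof.
move=> q0 t0.
have := congr1 (horner^~ a) (diffquoE x n).
rewrite hornerM hornerXsubC hornerD hornerN hornerXn hornerC => E.
rewrite /= !(hornerD, hornerZ, hornerXn) exprS.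
move: (diffquo x n).[a] E => S E.
have -> : x ^+ n = a ^+ n - (a - x) * S by rewrite E; ring.
by move: (a ^+ n) => an; rewrite /a /x /jouk; field; rewrite q0 t0.
Qed.

Lemma thetaSS q b c n : q != 0 ->
  theta q b c n.+2 = (q ^+ 2 + q ^- 2) * theta q b c n.+1 - theta q b c n.
Proof.
move=> q0; rewrite /theta.
have e k : (2 * k.+1%:Z = 2 * k%:Z + 2%:Z)%R by lia.
rewrite !e -!invr_expz !expfzDr //.
have := expfz_neq0 (2 * n%:Z) q0; move: (q ^ (2 * n%:Z)) => X X0.
by rewrite -[q ^ 2%:Z]/(q ^+ 2); field; rewrite q0 X0.
Qed.

Lemma theta0 q b c : theta q b c 0 = b + c.
Proof. by rewrite /theta mulr0 oppr0 expr0z !mulr1. Qed.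

Lemma theta1 q b c : theta q b c 1 = b * q ^+ 2 + c / q ^+ 2.
Proof. by rewrite /theta -invr_expz mulr1. Qed.

Lemma aw_polySS q b c Q s sg Z n (D := aw_poly q b c Q s sg Z) :
  D n.+2 = (q ^+ 2 + q ^- 2) *: (D n.+1 * 'X) - D n * 'X^2
    - (q ^+ 2 - q ^- 2) ^+ 2 *: D n
    + aw_lin q b c Q s sg Z *: 'X^(n.+1) + aw_cst q b c Q s sg Z *: 'X^n.
Proof. by []. Qed.

Lemma horner_aw_polySS q b c Q s sg Z n x (D := aw_poly q b c Q s sg Z) :
  (D n.+2).[x] =
    (q ^+ 2 + q ^- 2) * x * (D n.+1).[x] - x ^+ 2 * (D n).[x]
    - (q ^+ 2 - q ^- 2) ^+ 2 * (D n).[x]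
    + aw_lin q b c Q s sg Z * x ^+ n.+1 + aw_cst q b c Q s sg Z * x ^+ n.
Proof.
rewrite /D aw_polySS.
rewrite !(hornerD, hornerN, hornerZ, hornerXn, hornerX, hornerM, hornerMX).
by ring.
Qed.

(** Both sides obey the same recursion in [n], by [diffquo_rec] at [q] and at [q^-1]. The constant
    [aw_shift] settles [n = 1], while [aw_lin] and [aw_cst] account for the defects in [x^n]. *)
Lemma aw_poly_diff q b c Q s sg Z n t (x := jouk t)
    (g := aw_weight q b c Q s Z) :
    q != 0 -> Q != 0 -> t != 0 -> sg = b * Q + c / Q ->
  (t - t^-1) * (aw_poly q b c Q s sg Z n).[x] =
  (t - t^-1) * theta q b c 0 * x ^+ n
  + (q - q^-1) * (g t^-1 * (diffquo x n).[jouk (q ^+ 2 * t)]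
                  - g t * (diffquo x n).[jouk (q ^- 2 * t)]).
Proof.
move=> q0 Q0 t0 hsg.
elim/ltn_ind: n => -[|[|n]] IH.
- by rewrite /= !hornerE; ring.
- rewrite /= theta1 theta0 !(hornerD, hornerZ, hornerXn, hornerX, hornerC, horner0).
  rewrite /x /g /aw_weight /aw_shift /jouk; field.
  by rewrite q0 Q0 t0 oner_neq0.
have qV0 : q^-1 != 0 by rewrite invr_eq0.
have {}IH1 := IH n.+1 (leqnn _); have {}IH := IH n (leqnSn _).
have e2 : q ^- 2 = q^-1 ^+ 2 by rewrite exprVn.
rewrite horner_aw_polySS diffquo_rec // e2 (diffquo_rec _ qV0 t0) -!e2 !invrK.
move: IH1 IH; rewrite -/x.
set D1 := (aw_poly _ _ _ _ _ _ _ n.+1).[x]; set D0 := (aw_poly _ _ _ _ _ _ _ n).[x].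
set S1 := (diffquo x n.+1).[_]; set S0 := (diffquo x n).[_].
set T1 := (diffquo x n.+1).[_]; set T0 := (diffquo x n).[_].
move=> IH1 IH.
transitivity ((q ^+ 2 + q ^- 2) * x * ((t - t^-1) * D1)
  - (x ^+ 2 + (q ^+ 2 - q ^- 2) ^+ 2) * ((t - t^-1) * D0)
  + (t - t^-1) * (aw_lin q b c Q s sg Z * x ^+ n.+1 + aw_cst q b c Q s sg Z * x ^+ n)).
  by ring.
rewrite IH1 IH (exprS x n.+1) (exprS x n); move: (x ^+ n) => xn; clearbody S1 S0 T1 T0.
rewrite theta0 /x /g /aw_weight /aw_lin /aw_cst hsg /jouk. field.
by rewrite q0 Q0 t0 oner_neq0.
Qed.

(** The top coefficients follow the recursion [thetaSS]; the other terms of [aw_polySS] have lower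
    degree. *)
Lemma aw_poly_lead q b c Q s sg Z n (D := aw_poly q b c Q s sg Z) : q != 0 ->
  (size (D n) <= n.+1)%N /\ (D n)`_n = theta q b c n.
Proof.
move=> q0; elim/ltn_ind: n => -[|[|n]] IH.
- by rewrite /D /= size_polyC_leq1 coefC eqxx.
- rewrite /D /= coefD coefZ coefX coefC eqxx mulr1 addr0; split=> //.
  rewrite (leq_trans (size_polyD _ _)) // geq_max.
  rewrite (leq_trans (size_scale_leq _ _)) ?size_polyX //.
  exact: leq_trans (size_polyC_leq1 _) _.
have [s1 c1] := IH n.+1 (leqnn _); have [s0 c0] := IH n (leqnSn _).
rewrite /D aw_polySS -/D; split.
  apply/leq_sizeP => j lj.
  rewrite !(coefD, coefN, coefZ, coefMX, coefMXn, coefXn).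
  case: j lj => [|[|j]] // lj; rewrite !eqSS subn2 [_.+2.-1]/= [_.+2.-2]/=.
  have [nj1 nj] : ((j.+2 == n) = false /\ (j.+1 == n) = false)%N by split; lia.
  rewrite nj nj1 !(@nth_default _ _ (D _)); try lia.
  by rewrite !mulr0 !subr0 !addr0.
rewrite !(coefD, coefN, coefZ, coefMX, coefMXn, coefXn) /= subn2 /= c1 c0.
have [nj1 nj] : ((n.+2 == n) = false /\ (n.+1 == n) = false)%N by split; lia.
rewrite nj1 eqSS nj (@nth_default _ _ (D n)); last by lia.
by rewrite !mulr0 !addr0 subr0 thetaSS.
Qed.

Lemma aw_poly_eigen q b c Q s sg Z M (x t : 'I_M -> F)
    (g := aw_weight q b c Q s Z)
    (r := fun i => \prod_(j < M | j != i) ('X - (x j)%:P))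
    (P := \prod_(i < M) ('X - (x i)%:P)) :
    q != 0 -> Q != 0 -> sg = b * Q + c / Q -> injective x ->
    (forall i, [/\ x i = jouk (t i), t i != 0 & t i - (t i)^-1 != 0]) ->
    (forall i, g (t i)^-1 * (r i).[jouk (q ^+ 2 * t i)]
               = g (t i) * (r i).[jouk (q ^- 2 * t i)]) ->
  polylin (aw_poly q b c Q s sg Z) P = theta q b c M *: P.
Proof.
move=> q0 Q0 hsg x_inj xt bethe; apply/eqP; rewrite -subr_eq0; apply/eqP.
set D := aw_poly _ _ _ _ _ _ _; set E := _ - _.
have sP : size P = M.+1 by rewrite /P -big_enum size_prod_XsubC -cardE card_ord.
have lP : P`_M = 1.
  have := monic_prod_XsubC (index_enum 'I_M) xpredT x.
  by rewrite monicE lead_coefE sP => /eqP.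
(* [P] is monic and [D] multiplies its leading coefficient by [theta q b c M], so the top terms of
   [E] cancel; [M] distinct roots then force [E = 0]. *)
have sE : (size E <= M)%N.
  apply/leq_sizeP => j; rewrite leq_eqVlt coefB coefZ => /orP[/eqP<-|lj].
    rewrite lP mulr1 /polylin sP coef_sum big_ord_recr /= coefZ lP mul1r.
    rewrite (aw_poly_lead _ _ _ _ _ _ _ q0).2 big1 ?add0r ?subrr // => i _.
    rewrite coefZ (@nth_default _ _ (D i)) ?mulr0 //.
    exact: leq_trans (aw_poly_lead _ _ _ _ _ _ _ q0).1 (ltn_ord i).
  rewrite [P`_j]nth_default ?sP // mulr0 subr0 coef_sum big1 // => i _.
  rewrite coefZ (@nth_default _ _ (D i)) ?mulr0 //.
  apply: leq_trans (aw_poly_lead _ _ _ _ _ _ _ q0).1 _.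
  by apply: leq_trans (ltn_ord i) _; rewrite sP.
apply: (@roots_geq_poly_eq0 _ _ [seq x i | i <- enum 'I_M]).
- apply/allP => _ /mapP[i _ ->]; rewrite rootE.
  have [xi ti0 ti1] := xt i.
  have PE : P = ('X - (x i)%:P) * r i + 0%:P by rewrite addr0 /P (bigD1 i).
  have Px : P.[x i] = 0 by rewrite PE hornerD hornerM hornerXsubC subrr mul0r add0r hornerC.
  rewrite hornerD hornerN hornerZ Px mulr0 subr0 -(mulrI_eq0 _ (mulfI ti1)).
  (* Since [P] vanishes at [x i], its divided difference there is [r i]. *)
  have dq a : \sum_(k < size P) P`_k * (diffquo (x i) k).[a] = (r i).[a].
    rewrite -(polylin_diffquo (x i) 0 (r i)) -PE horner_sum.
    by apply: eq_bigr => k _; rewrite hornerZ.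
  rewrite horner_sum mulr_sumr.
  under eq_bigr => k _ do rewrite hornerZ mulrCA xi aw_poly_diff // -xi mulrDr.
  rewrite big_split /=.
  have -> : \sum_(k < size P) P`_k * ((t i - (t i)^-1) * theta q b c 0 * x i ^+ k) = 0.
    transitivity ((t i - (t i)^-1) * theta q b c 0 * P.[x i]); last by rewrite Px mulr0.
    by rewrite horner_coef mulr_sumr; apply: eq_bigr => k _; rewrite mulrCA.
  rewrite add0r.
  transitivity ((q - q^-1) * (g (t i)^-1 * (r i).[jouk (q ^+ 2 * t i)]
      - g (t i) * (r i).[jouk (q ^- 2 * t i)]) == 0).
    congr (_ == _); rewrite -!dq !mulr_sumr -sumrB mulr_sumr.
    by apply: eq_bigr => k _; rewrite /g; ring.
  by rewrite bethe subrr mulr0 eqxx.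
- by rewrite map_inj_uniq ?enum_uniq.
- by rewrite size_map -cardE card_ord.
Qed.

End DifferenceOperator.


(** * Row vectors [w p(Y)] and the right action of [A] on them *)

Section PolynomialRow.
Variables (F : fieldType) (T : Type) (w : T -> F) (Y : T -> T).
Implicit Types (p r : {poly F}) (x : T).

(* The value at [x] of the row vector [w p(Y)]. *)
Definition row_poly p x : F := polylin (W := F^o) (fun n => w (iter n Y x)) p.

Lemma row_polyMX p x : row_poly (p * 'X) x = row_poly p (Y x).
Proof.
rewrite /row_poly polylinMX; apply: eq_bigr => i _; by rewrite iterSr.
Qed.

Lemma row_polyD p r x : row_poly (p + r) x = row_poly p x + row_poly r x.
Proof. exact: (@polylinD F F^o). Qed.

Lemma row_polyB p r x : row_poly (p - r) x = row_poly p x - row_poly r x.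
Proof. exact: (@polylinB F F^o). Qed.

Lemma row_polyZ a p x : row_poly (a *: p) x = a * row_poly p x.
Proof. exact: (@polylinZ F F^o). Qed.

Lemma row_polyC a x : row_poly a%:P x = a * w x.
Proof. exact: (@polylinC F F^o). Qed.

Lemma row_polyXn n x : row_poly 'X^n x = w (iter n Y x).
Proof. exact: (@polylinXn F F^o). Qed.

Variables (A : T -> T) (q b c Q s sg Z : F).
Let D := aw_poly q b c Q s sg Z.

Hypothesis rowA : forall x, w (A x) = theta q b c 0 * w x.
Hypothesis rowYA : forall x,
  w (Y (A x)) = theta q b c 1 * w (Y x) + aw_shift q b c Q s Z * w x.
Hypothesis rowYYA : forall n x (m := fun x => w (iter n Y x)),
  m (Y (Y (A x))) = (q ^+ 2 + q ^- 2) * m (Y (A (Y x))) - m (A (Y (Y x)))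
    - (q ^+ 2 - q ^- 2) ^+ 2 * m (A x)
    + aw_lin q b c Q s sg Z * m (Y x) + aw_cst q b c Q s sg Z * m x.

(** [rowYYA] reduces [w Y^(n+2) A] to [w Y^(n+1) A Y], [w Y^n A Y^2], [w Y^n A] and powers of [Y]. A
    trailing [Y] is a multiplication by ['X], so this is the recursion defining [aw_poly]. *)
Lemma row_iter_aw n x : w (iter n Y (A x)) = row_poly (D n) x.
Proof.
elim/ltn_ind: n x => -[|[|n]] IH x.
- by rewrite /D /= row_polyC rowA.
- rewrite /D /= row_polyD row_polyZ row_polyC rowYA.
  by rewrite -[X in row_poly X]expr1 row_polyXn.
rewrite !iterSr rowYYA -!iterSr !IH // /D aw_polySS -/D.
rewrite !(row_polyB, row_polyD, row_polyZ, row_polyMX, row_polyXn).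
by rewrite (expr2 'X) mulrA !row_polyMX.
Qed.

Lemma row_poly_aw p x : row_poly p (A x) = row_poly (polylin D p) x.
Proof.
rewrite /row_poly [LHS]/polylin.
under eq_bigr => i _ do rewrite row_iter_aw.
rewrite {2}/polylin; elim/big_rec2: _ => [|i y1 y2 _ IH]; first by rewrite polylin0.
by rewrite polylinD polylinZ IH.
Qed.

End PolynomialRow.

(** * The Bethe equations as conditions on the roots of [p] *)

Section BetheRoots.
Variable F : fieldType.
Implicit Types (q b c bs cs z u v : F) (d M : nat).

Lemma bethe_U_jouk q u : bethe_U q u = jouk (q * u ^+ 2) / (q + q^-1).
Proof. by rewrite /bethe_U /jouk (invfM q). Qed.

(** By [jouk (x * y) - jouk (x / y) = bfun x * bfun y], the factor [f(u,v)] is the ratio of the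
    values of ['X - jouk (q v^2)] at [jouk (q^-2 t)] and [jouk t], where [t = q u^2]. *)
Lemma ffun_f_jouk q u v : q != 0 -> u != 0 -> v != 0 ->
  jouk (q * u ^+ 2) - jouk (q * v ^+ 2) != 0 ->
  ffun_f q u v * (jouk (q * u ^+ 2) - jouk (q * v ^+ 2))
  = jouk (q ^- 2 * (q * u ^+ 2)) - jouk (q * v ^+ 2).
Proof.
move=> q0 u0 v0; have E : jouk (q * u ^+ 2) - jouk (q * v ^+ 2)
  = - (bfun (v / u) * bfun (q * u * v)).
  by rewrite /jouk /bfun; field; rewrite q0 u0 v0.
rewrite E oppr_eq0 => nz; rewrite /ffun_f mulrN divfK //.
by rewrite /jouk /bfun; field; rewrite q0 u0 v0.
Qed.

Lemma ffun_h_jouk q u v : q != 0 -> u != 0 -> v != 0 ->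
  jouk (q * u ^+ 2) - jouk (q * v ^+ 2) != 0 ->
  ffun_h q u v * (jouk (q * u ^+ 2) - jouk (q * v ^+ 2))
  = jouk (q ^+ 2 * (q * u ^+ 2)) - jouk (q * v ^+ 2).
Proof.
move=> q0 u0 v0; have E : jouk (q * u ^+ 2) - jouk (q * v ^+ 2)
  = bfun (q * u * v) * bfun (u / v).
  by rewrite /jouk /bfun; field; rewrite q0 u0 v0.
rewrite E => nz; rewrite /ffun_h divfK //.
by rewrite /jouk /bfun; field; rewrite q0 u0 v0.
Qed.

(* The common factor [e] of [Lambda1] and [Lambda2] cancels in the equations. *)
Lemma bethe_eigen q b c d bs cs z eps b' c' s sg (e : F -> F) M (u : 'I_M -> F)
    (g := aw_weight q b' c' (q ^+ d) s (z ^+ 2 + z ^- 2)) :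
    q != 0 -> sg = b' * q ^+ d + c' / q ^+ d ->
    (forall v, v != 0 -> e v != 0) ->
    (forall v, v != 0 ->
       Lambda1 q d b c bs cs z eps v = e v * g (q * v ^+ 2)) ->
    (forall v, v != 0 -> bfun (q * v ^+ 2) != 0 ->
       Lambda2 q d b c bs cs z eps v
       = bfun (v ^+ 2) / bfun (q * v ^+ 2) * e v * g (q * v ^+ 2)^-1) ->
    bethe_solution q d b c bs cs z eps u ->
  let P := \prod_(i < M) ('X - (jouk (q * u i ^+ 2))%:P) in
  polylin (aw_poly q b' c' (q ^+ d) s sg (z ^+ 2 + z ^- 2)) P = theta q b' c' M *: P.
Proof.
move=> q0 hsg e0 L1 L2 [nontriv adm hbq bethe].
have jd i j : j != i -> jouk (q * u i ^+ 2) - jouk (q * u j ^+ 2) != 0.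
  move=> ji; have := adm i j; rewrite eq_sym ji => /(_ isT).
  by apply: contra; rewrite subr_eq0 !bethe_U_jouk => /eqP ->.
apply: (@aw_poly_eigen _ q b' c' _ s sg _ M _ (fun i => q * u i ^+ 2)) => //.
- by rewrite expf_neq0.
- move=> i j /eqP; apply: contraTeq => ij.
  by rewrite -subr_eq0 jd // eq_sym.
- move=> i; have [ui0 _] := nontriv i; split=> //; last exact: hbq.
  by rewrite mulf_neq0 // expf_neq0.
move=> i /=; have [ui0 ui1] := nontriv i; have := bethe i.
set t := q * u i ^+ 2; pose R := \prod_(j < M | j != i) (jouk t - jouk (q * u j ^+ 2)).
have R0 : R != 0 by apply/prodf_neq0 => j; apply: jd.
have bu0 : bfun (u i ^+ 2) != 0 by rewrite /bfun subr_eq0.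
(* Common factors are cleared, and [R] turns the products of [f] and [h] into values, at the two
   shifted points, of the polynomial without its factor at [u i]. *)
move/(congr1 (fun y => y * (R * bfun t / bfun (u i ^+ 2) / e (u i)))).
rewrite mul0r /bethe_E L1 // L2 // => E.
have rf : (\prod_(j < M | j != i) ('X - (jouk (q * u j ^+ 2))%:P)).[jouk (q ^- 2 * t)]
    = (\prod_(j < M | j != i) ffun_f q (u i) (u j)) * R.
  rewrite horner_prod -big_split /=; apply: eq_bigr => j ji.
  by rewrite hornerXsubC ffun_f_jouk ?(nontriv _).1 ?jd.
have rh : (\prod_(j < M | j != i) ('X - (jouk (q * u j ^+ 2))%:P)).[jouk (q ^+ 2 * t)]
    = (\prod_(j < M | j != i) ffun_h q (u i) (u j)) * R.
  rewrite horner_prod -big_split /=; apply: eq_bigr => j ji.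
  by rewrite hornerXsubC ffun_h_jouk ?(nontriv _).1 ?jd.
rewrite rf rh -/g.
move: (\prod_(_ < _ | _) ffun_f _ _ _) (\prod_(_ < _ | _) ffun_h _ _ _) E => X1 X2 E.
apply/eqP; rewrite -subr_eq0 -[X in _ == X]E; apply/eqP.
have ei0 := e0 _ ui0; have bt0 := hbq i; rewrite -/t in bt0 *.
by field; rewrite ei0 bt0 bu0.
Qed.

End BetheRoots.


(** * Row vectors evaluated on an eigenbasis *)

Section Eigenbasis.
Variables (F : fieldType) (V : vectType F) (d : nat).
Variables (P Y : 'End(V)) (th : 'I_d.+1 -> V) (bth : 'I_d.+1 -> 'Hom(V, F^o)).
Variables (xi : 'I_d.+1 -> F) (ev : nat -> F).
Hypothesis th_basis : basis_of fullv [seq th M | M <- enum 'I_d.+1].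
Hypothesis P_th : forall M : 'I_d.+1, P (th M) = ev M *: th M.
Hypothesis ev_inj : injective (fun M : 'I_d.+1 => ev M).
Hypothesis xi_neq0 : forall M, xi M != 0.
Hypothesis bth_th : forall M' M, bth M' (th M) = (M == M')%:R * xi M.

Lemma hom_eq_on_basis (f g : 'Hom(V, F^o)) :
  (forall M, f (th M) = g (th M)) -> f = g.
Proof.
move=> fg; apply/lfunP => x.
have: x \in <<[seq th M | M <- enum 'I_d.+1]>>%VS.
  by rewrite (span_basis th_basis) memvf.
move: x; apply/span_lfunP => _ /mapP[M _ ->]; exact: fg.
Qed.

(** [w Y^n] as a linear form: this supplies the linearity in the vector, which [row_poly], built on
    bare functions, does not carry. *)
Definition row_pow (w : 'Hom(V, F^o)) n : 'Hom(V, F^o) :=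
  iter n (fun f => (f \o Y)%VF) w.

Lemma row_powE w n x : row_pow w n x = w (iter n Y x).
Proof. by elim: n x => // n IH x; rewrite iterSr -IH /= comp_lfunE. Qed.

Local Notation rowp w := (@row_poly F V w Y).

(* Otherwise the span of the [th M] with [k < M] would be invariant. *)
Lemma irreducible_super_neq0 (B : 'End(V)) (a : nat -> nat -> F) k :
    irreducible_action P B ->
    (forall M : 'I_d.+1, B (th M) = \sum_(M' < d.+1) a M' M *: th M') ->
    (forall i j, (i.+1 < j)%N -> a i j = 0) ->
  (k < d)%N -> a k k.+1 != 0.
Proof.
move=> irr B_th a_tri ltkd; apply/negP => /eqP akk.
pose W := <<[seq th M | M : 'I_d.+1 <- enum 'I_d.+1 & (k < M)%N]>>%VS.
have thW (M : 'I_d.+1) : (k < M)%N -> th M \in W.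
  by move=> kM; apply/memv_span/map_f; rewrite mem_filter kM mem_enum.
have W_ind (f : 'End(V)) : (forall M : 'I_d.+1, (k < M)%N -> f (th M) \in W) ->
    (f @: W <= W)%VS.
  move=> fW; rewrite limg_span; apply/span_subvP => _ /mapP[_ /mapP[M +] -> ->].
  by rewrite mem_filter => /andP[kM _]; apply: fW.
have kd : (k < d.+1)%N by apply: ltnW.
case: (irr W).
- by apply: W_ind => M kM; rewrite P_th memvZ // thW.
- apply: W_ind => M kM; rewrite B_th; apply: memv_suml => M' _.
  have [kM'|M'k] := ltnP k M'; first by rewrite memvZ // thW.
  suff -> : a M' M = 0 by rewrite scale0r mem0v.
  have [lt|ge] := ltnP M'.+1 M; first exact: a_tri.
  have -> : (M' = k :> nat) by lia.
  by have -> : (M = k.+1 :> nat) by lia.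
- move=> W0; have : th (Ordinal (ltkd : k.+1 < d.+1)%N) \in W by apply: thW.
  rewrite W0 memv0 => /eqP th0.
  have := bth_th (Ordinal (ltkd : k.+1 < d.+1)%N) (Ordinal (ltkd : k.+1 < d.+1)%N).
  by rewrite th0 linear0 eqxx mul1r => /esym/eqP; apply/negP.
(* [W] is not the whole space: the form [bth k] kills it but not [th k]. *)
move=> WV; have : (W <= lker (bth (Ordinal kd)))%VS.
  apply/span_subvP => _ /mapP[M + ->]; rewrite mem_filter => /andP[kM _].
  rewrite memv_ker bth_th; case: (M =P Ordinal kd) => [E|]; last by rewrite mul0r.
  by move: kM; rewrite E ltnn.
rewrite WV => /subvP/(_ _ (memvf (th (Ordinal kd)))).
by rewrite memv_ker bth_th eqxx mul1r; apply/negP.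
Qed.

Variable yc : nat -> nat -> F.
Hypothesis Y_th : forall M : 'I_d.+1, Y (th M) = \sum_(M' < d.+1) yc M' M *: th M'.
Hypothesis yc_tri : forall i j, (i.+1 < j)%N -> yc i j = 0.

(** [Y] lowers the index by at most one, so [n] steps from [j] miss 0 when [n < j], and for [n = j]
    the only path runs down the superdiagonal. *)
Lemma row_iter_th n (j : 'I_d.+1) : (n <= j)%N ->
  bth ord0 (iter n Y (th j))
  = (n == j)%:R * (\prod_(k < j) yc k k.+1 * xi ord0).
Proof.
elim: n j => [|n IH] j le_nj.
  rewrite [iter _ _ _]/= bth_th; case: eqP => [->|ne].
    by rewrite big_ord0 !mul1r.
  suff -> : (0%N == j :> nat) = false by rewrite !mul0r.
  by apply/negP => /eqP j0; apply: ne; apply: val_inj.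
rewrite iterSr -row_powE Y_th linear_sum.
have jd : (j.-1 < d.+1)%N by apply: leq_ltn_trans (leq_pred _) (ltn_ord j).
have jS : (j : nat) = (Ordinal jd).+1 by rewrite /=; lia.
rewrite (bigD1 (Ordinal jd)) //= big1 ?addr0 => [|M' neM'].
  rewrite linearZ /= row_powE IH /=; last by lia.
  rewrite jS /= big_ord_recr /= -[_ *: _]/(_ * _) eqSS; ring.
rewrite linearZ /= row_powE.
have [lt|ge] := ltnP M'.+1 j; first by rewrite yc_tri // scale0r.
have ltn : (n < M')%N.
  have: (M' : nat) != j.-1 by apply: contra neM' => /eqP E; apply/eqP/val_inj.
  by lia.
by rewrite IH ?(ltnW ltn) // ltn_eqF // mul0r scaler0.
Qed.

Lemma row_poly_th (p : {poly F}) (M : 'I_d.+1) : (size p <= M.+1)%N ->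
  rowp (bth ord0) p (th M) = p`_M * (\prod_(k < M) yc k k.+1 * xi ord0).
Proof.
move=> sp; rewrite /row_poly (polylin_widen _ sp) big_ord_recr /=.
rewrite row_iter_th // eqxx mul1r big1 ?add0r // => i _.
by rewrite row_iter_th ?(ltnW (ltn_ord i)) // ltn_eqF ?mul0r ?scaler0.
Qed.

Lemma dual_bethe_state_row (C : F -> int -> 'End(V)) (Om : 'Hom(V, F^o)) M
    (u : 'I_M -> F) (m0 : int) (e y : 'I_M -> F) x :
    (forall k : 'I_M, C (u k) (m0 + 2 * k.+1%:Z) = e k *: (Y - y k *: \1%VF)) ->
  dual_bethe_state Om C u m0 x
  = \prod_(k < M) e k * rowp Om (\prod_(k < M) ('X - (y k)%:P)) x.
Proof.
move=> CE; rewrite /dual_bethe_state -!big_enum /=.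
(* The induction runs over an arbitrary accumulator of [foldl], taken as a multiple of a row
   [w r(Y)]. *)
suff H : forall s (psi : 'Hom(V, F^o)) c r, (forall x, psi x = c * rowp Om r x) ->
    foldl (fun psi (k : 'I_M) => (psi \o C (u k) (m0 + 2 * k.+1%:Z))%VF) psi s x
    = (c * \prod_(k <- s) e k)
      * rowp Om (r * \prod_(k <- s) ('X - (y k)%:P)) x.
  rewrite (H _ _ 1 1) ?mul1r // => z; rewrite mul1r.
  by rewrite -polyC1 row_polyC mul1r.
elim=> [|k s IH] psi c0 r psiE /=; first by rewrite !big_nil !mulr1.
rewrite (IH _ (c0 * e k) (r * ('X - (y k)%:P))) => [|z].
  by rewrite !big_cons !mulrA.
rewrite comp_lfunE CE scale_lfunE linearZ /= add_lfunE opp_lfunE scale_lfunE.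
rewrite id_lfunE linearB linearZ /= !psiE mulrBr row_polyB row_polyMX.
rewrite [r * _]mulrC mul_polyC row_polyZ.
rewrite -[_ *: (_ - _)]/(_ * (_ - _)) -[_ *: _]/(_ * _); ring.
Qed.

(** The row [w p(Y)] is a left eigenvector of [P] for [ev M], a simple eigenvalue by [ev_inj], so it
    vanishes on [th j] for [j != M]. As [p] is monic of degree [M], its value on [th M] is a product
    of superdiagonal entries, which gives the factor. *)
Lemma dual_eigenvector_bethe (C : F -> int -> 'End(V)) (M : 'I_d.+1)
    (u : 'I_M -> F) (m0 : int) (e y n : 'I_M -> F) (a : nat -> nat -> F)
    (p := \prod_(k < M) ('X - (y k)%:P)) :
    (forall k : 'I_M, C (u k) (m0 + 2 * k.+1%:Z) = e k *: (Y - y k *: \1%VF)) ->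
    (forall x, rowp (bth ord0) p (P x) = ev M * rowp (bth ord0) p x) ->
    (forall k : 'I_M, e k * yc k k.+1 = n k * a k k.+1) ->
    (forall k, n k != 0) -> (forall k, (k < d)%N -> a k k.+1 != 0) ->
  bth M = \prod_(k < M) (n k * dual_coef a xi k k.+1)^-1
          *: dual_bethe_state (bth ord0) C u m0.
Proof.
move=> CE eig ey n0 a0; apply: hom_eq_on_basis => j.
rewrite bth_th scale_lfunE (dual_bethe_state_row _ _ CE) -/p.
have [->|ne] := eqVneq j M; last first.
  suff -> : rowp (bth ord0) p (th j) = 0 by rewrite mul0r mulr0 scaler0.
  pose f := polylin (row_pow (bth ord0)) p.
  have fE x : f x = rowp (bth ord0) p x.
    rewrite /f /polylin sum_lfunE.
    by apply: eq_bigr => i _; rewrite scale_lfunE row_powE.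
  have := eig (th j); rewrite P_th -!fE linearZ /= => /eqP.
  rewrite -subr_eq0 -mulrBl mulf_eq0 subr_eq0 => /orP[/eqP E|/eqP //].
  by move: ne; rewrite (ev_inj E) eqxx.
have sp : size p = M.+1 by rewrite /p -big_enum size_prod_XsubC -cardE card_ord.
have lp : p`_M = 1.
  have := monic_prod_XsubC (index_enum 'I_M) xpredT y.
  by rewrite monicE lead_coefE sp => /eqP.
rewrite row_poly_th ?sp // lp !mul1r [in RHS]mulrA -big_split /=.
under [X in _ *: (X * _)]eq_bigr do rewrite ey.
rewrite -[_ *: _]/(_ * _) prodfV.
(* The ratios of [xi] inside [dual_coef] telescope, converting [xi ord0] into [xi M]. *)
have tel m : \prod_(k < m) (xi (inord k) / xi (inord k.+1)) * xi (inord m) = xi ord0.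
  elim: m => [|m IH]; first by rewrite big_ord0 mul1r; congr xi; apply/val_inj; rewrite /= inordK.
  by rewrite big_ord_recr /= -mulrA divfK ?IH.
rewrite -(tel M) inord_val [X in _ = _ * X]mulrA -big_split /=.
under [X in _ * (X * _)]eq_bigr => k _ do rewrite -mulrA [a _ _ * _]mulrA.
rewrite mulKf //; apply/prodf_neq0 => k _; rewrite /dual_coef !mulf_neq0 ?invr_eq0 //.
by apply: a0; have := ltn_ord k; have := ltn_ord M; lia.
Qed.

End Eigenbasis.


(** * Explicit coefficients: the corner entry, the Bethe weights and the structure constants *)

Lemma super_coef1 (F : fieldType) (q : F) d b c bs cs z (Q := q ^+ d) :
    q != 0 -> z != 0 -> coef_defined q d b c ->
  (c - b * q ^+ 2) * super_coef q d b c bs cs z 1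
  = (1 - Q ^- 2) * (c + bs * z ^- 2 * q * Q) * (cs + b * z ^+ 2 * q * Q).
Proof.
move=> q0 z0 hdef; have Q0 : Q != 0 by rewrite expf_neq0.
rewrite /super_coef.
have -> : 2 * 1%:Z - 2 * d%:Z - 2 = - (d%:Z + d%:Z) by lia.
have -> : 2 * 1%:Z + d%:Z - 1 = d%:Z + 1 by lia.
have qdd : q ^ (d%:Z + d%:Z) = Q * Q by rewrite expfzDr.
have qd1 : q ^ (d%:Z + 1) = Q * q by rewrite expfzDr.
rewrite -invr_expz qdd qd1.
rewrite (_ : 2 * 1%:Z - 2 = 0) // (_ : 4 * 1%:Z - 4 = 0) // (_ : 4 * 1%:Z - 2 = 2%:Z) //.
rewrite expr0z !mulr1 -[q ^ 2%:Z]/(q ^+ 2).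
(* For [d = 0] the hypothesis on denominators is empty, but then [Q = 1] and both sides vanish
   through [1 - Q^-2]. *)
have [d0|d0] := posnP d; first by rewrite /Q d0 expr0 expr1n !mul1r invr1 subrr !mul0r mulr0.
have [/=] := hdef 1%N d0.
rewrite (_ : 4 * 1%:Z - 4 = 0) // (_ : 4 * 1%:Z - 2 = 2%:Z) // expr0z mulr1.
rewrite -[q ^ 2%:Z]/(q ^+ 2) => n1 n2 _.
by field; rewrite Q0 z0 n1 n2.
Qed.

Lemma leonard_coef00 (F : fieldType) (q : F) d b c bs cs z (Q := q ^+ d) :
    q != 0 -> z != 0 -> coef_defined q d b c ->
  leonard_coef q d b c bs cs z 0 0 * (c - b * q ^+ 2)
  = (bs + cs) * (c - b * q ^+ 2)
     - (1 - Q ^- 2) * (c + bs * z ^- 2 * q * Q) * (cs + b * z ^+ 2 * q * Q).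
Proof.
move=> q0 z0 hdef; rewrite -super_coef1 // /leonard_coef /= theta0 /sub_coef.
rewrite mulr0 expr0z subrr !mul0r mulr0 mul0r; ring.
Qed.

Section Coefficients.
Variables (F : fieldType) (q : F) (d : nat) (b c bs cs z : F).
Hypotheses (q0 : q != 0) (b0 : b != 0) (c0 : c != 0) (bs0 : bs != 0).
Hypotheses (cs0 : cs != 0) (z0 : z != 0) (bcE : b * c = bs * cs).

Let Q := q ^+ d.
Let Q0 : Q != 0. Proof. by rewrite expf_neq0. Qed.
Let bsE : bs = b * c / cs. Proof. by rewrite bcE mulfK. Qed.

Let qd1 : q ^ (d%:Z + 1) = Q * q.
Proof. by rewrite expfzDr. Qed.
Let qd1N : q ^ (- d%:Z - 1) = (Q * q)^-1.
Proof. by rewrite -opprD -invr_expz qd1. Qed.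
Let qdN : q ^ (- d%:Z) = Q^-1.
Proof. by rewrite -invr_expz. Qed.
Let qdm1 : q ^ (d%:Z - 1) = Q / q.
Proof. by rewrite expfzDr. Qed.

(** The two factors in [z] multiply to [Q t - Z + 1/(Q t)] up to the factor [Q q], with [t = q u^2];
    in the product of the last two, [b c / cs] becomes [bs]. *)
Lemma Lambda1_minus u : u != 0 ->
  Lambda1 q d b c bs cs z (-1) u
  = u * aw_weight q b c Q (bs * Q + cs / Q) (z ^+ 2 + z ^- 2) (q * u ^+ 2).
Proof.
move=> u0; rewrite /Lambda1 qd1 qd1N qdN -[q ^ d]/Q.
rewrite (_ : ((1 - -1) %/ 2)%Z = 1) // (_ : ((1 + -1) %/ 2)%Z = 0) //.
rewrite expr1z expr0z exprN1 /aw_weight bsE; field.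
by rewrite cs0 u0 z0 q0 Q0 ?oner_neq0.
Qed.

Lemma Lambda2_minus u : u != 0 -> bfun (q * u ^+ 2) != 0 ->
  Lambda2 q d b c bs cs z (-1) u
  = bfun (u ^+ 2) / bfun (q * u ^+ 2) * u
    * aw_weight q b c Q (bs * Q + cs / Q) (z ^+ 2 + z ^- 2) (q * u ^+ 2)^-1.
Proof.
move=> u0 bu0; rewrite /Lambda2 qdm1 qd1N qdN -[q ^ d]/Q.
rewrite (_ : ((1 - -1) %/ 2)%Z = 1) // (_ : ((1 + -1) %/ 2)%Z = 0) //.
rewrite expr1z expr0z exprN1 /aw_weight bsE.
rewrite -[u ^+ 2 - u ^- 2]/(bfun (u ^+ 2)).
have -> : q * u ^+ 2 - q^-1 * u ^- 2 = bfun (q * u ^+ 2) by rewrite /bfun (invfM q).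
move: (bfun _) bu0 (bfun _) => B B0 B'; field.
by rewrite cs0 u0 z0 q0 Q0 B0 ?oner_neq0.
Qed.

Lemma Lambda1_plus u : u != 0 ->
  Lambda1 q d b c bs cs z 1 u
  = u^-1 * aw_weight q bs cs Q (b * Q + c / Q) (z ^+ 2 + z ^- 2) (q * u ^+ 2).
Proof.
move=> u0; rewrite /Lambda1 qd1 qd1N qdN -[q ^ d]/Q.
rewrite (_ : ((1 - 1) %/ 2)%Z = 0) // (_ : ((1 + 1) %/ 2)%Z = 1) //.
rewrite expr1z !expr0z /aw_weight bsE; field.
by rewrite cs0 b0 u0 z0 q0 Q0 ?oner_neq0.
Qed.

Lemma Lambda2_plus u : u != 0 -> bfun (q * u ^+ 2) != 0 ->
  Lambda2 q d b c bs cs z 1 u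
  = bfun (u ^+ 2) / bfun (q * u ^+ 2) * u^-1
    * aw_weight q bs cs Q (b * Q + c / Q) (z ^+ 2 + z ^- 2) (q * u ^+ 2)^-1.
Proof.
move=> u0 bu0; rewrite /Lambda2 qdm1 qd1N qdN -[q ^ d]/Q.
rewrite (_ : ((1 - 1) %/ 2)%Z = 0) // (_ : ((1 + 1) %/ 2)%Z = 1) //.
rewrite expr1z !expr0z /aw_weight bsE.
rewrite -[u ^+ 2 - u ^- 2]/(bfun (u ^+ 2)).
have -> : q * u ^+ 2 - q^-1 * u ^- 2 = bfun (q * u ^+ 2) by rewrite /bfun (invfM q).
move: (bfun _) bu0 (bfun _) => B B0 B'; field.
by rewrite cs0 b0 u0 z0 q0 Q0 B0 ?oner_neq0.
Qed.

Hypotheses (K0 : q ^+ 2 - q ^- 2 != 0).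
Let K := q - q^-1.
Let Kp := q + q^-1.
Let KKp : q ^+ 2 - q ^- 2 = K * Kp. Proof. by rewrite /K /Kp; field. Qed.
Let Kn0 : K != 0. Proof. by move: K0; rewrite KKp mulf_eq0 negb_or => /andP[]. Qed.
Let Kp0 : Kp != 0. Proof. by move: K0; rewrite KKp mulf_eq0 negb_or => /andP[]. Qed.

(** Together with [aw_eta_cst], this matches the constants in the recursion of [D] with the
    coefficients of [Y] and of the identity in [aw_eliminate]. *)
Lemma aw_eta_lin : aw_lin q b c Q (bs * Q + cs / Q) (b * Q + c / Q) (z ^+ 2 + z ^- 2)
  = K * aw_eta q d b c bs cs z / (b * c * (q ^+ 2 - q ^- 2)).
Proof.
rewrite /aw_lin /aw_eta qd1 qd1N qdN -[q ^ d]/Q /jouk [q * Q]mulrC.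
move: (Q * q) (_ + z ^- 2) => Qq Z.
rewrite KKp -/K -/Kp; move: (Qq^-1) => Qq'; field.
by rewrite Q0 Kn0 Kp0 b0 c0.
Qed.

Lemma aw_eta_cst : aw_cst q b c Q (bs * Q + cs / Q) (b * Q + c / Q) (z ^+ 2 + z ^- 2)
  = (q ^+ 2 - q ^- 2) * aw_eta q d bs cs b c z / (b * c * (q ^+ 2 - q ^- 2)).
Proof.
rewrite /aw_cst /aw_eta qd1 qd1N qdN -[q ^ d]/Q /jouk [q * Q]mulrC -bcE.
move: (Q * q) (_ + z ^- 2) => Qq Z.
rewrite KKp -/K -/Kp; move: (Qq^-1) => Qq'; field.
by rewrite Q0 Kn0 Kp0 b0 c0.
Qed.

Let kap := b * c * (q ^+ 2 - q ^- 2).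
Let tau := aw_omega q d b c bs cs z / K.

Let qq1 : q * q - 1 != 0.
Proof. by have -> : q * q - 1 = q * K; [rewrite /K; field | rewrite mulf_neq0]. Qed.
Let qq1' : q * q + 1 != 0.
Proof. by have -> : q * q + 1 = q * Kp; [rewrite /Kp; field | rewrite mulf_neq0]. Qed.
Let qq2 : (q * q) ^+ 2 - 1 != 0.
Proof.
have -> : (q * q) ^+ 2 - 1 = (q * q - 1) * (q * q + 1) by ring.
by rewrite mulf_neq0.
Qed.

(** The left side is the constant that [rowYA] extracts from an Askey-Wilson relation and row 0 of
    [Y]; the explicit diagonal entry at index 0 makes it the constant term of [D 'X]. *)
Lemma aw_shift_minus : coef_defined q d b c ->
  q * aw_eta q d b c bs cs z / kap
  + (leonard_coef q d b c bs cs z 0 0 * (q - q^-1) * (c - b * q ^+ 2) + tau) / b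
  = aw_shift q b c Q (bs * Q + cs / Q) (z ^+ 2 + z ^- 2).
Proof.
move=> hdef; set a := leonard_coef _ _ _ _ _ _ _ _ _.
have -> : a * (q - q^-1) * (c - b * q ^+ 2) = K * (a * (c - b * q ^+ 2)).
  by rewrite /K; ring.
rewrite /a leonard_coef00 // -/Q.
rewrite /tau /kap /aw_omega /aw_shift /aw_eta qd1 qd1N qdN -[q ^ d]/Q bsE /K; field.
by rewrite q0 Q0 z0 cs0 b0 c0 qq1 qq1' qq2 ?oner_neq0.
Qed.

Lemma aw_shift_plus : coef_defined q d bs cs ->
  - (q^-1 * aw_eta q d bs cs b c z / kap)
  - (leonard_coef q d bs cs b c z^-1 0 0 * (q - q^-1) * (bs - cs * q ^- 2) + tau) / cs
  = aw_shift q bs cs Q (b * Q + c / Q) (z ^+ 2 + z ^- 2).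
Proof.
move=> hdef; have -> : bs - cs * q ^- 2 = - q ^- 2 * (cs - bs * q ^+ 2) by field.
set a := leonard_coef _ _ _ _ _ _ _ _ _.
have -> : a * (q - q^-1) * (- q ^- 2 * (cs - bs * q ^+ 2))
    = - q ^- 2 * K * (a * (cs - bs * q ^+ 2)) by rewrite /K; ring.
rewrite /a leonard_coef00 ?invr_eq0 // -/Q.
rewrite /tau /kap /aw_omega /aw_shift /aw_eta qd1 qd1N qdN -[q ^ d]/Q bsE /K !exprVn; field.
by rewrite q0 Q0 z0 cs0 b0 c0 qq1 qq1' qq2 ?oner_neq0.
Qed.
End Coefficients.


(** * The operator [Y] and the Askey-Wilson relations rewritten with it *)

Section Operators.
Variables (F : fieldType) (V : vectType F).
Implicit Types (f : 'Hom(V, F^o)) (x : V).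

Lemma scale_regular (a : F) (y : F^o) : a *: y = a * y :> F.
Proof. by []. Qed.

(* Eliminating [N] from the two relations leaves an Askey-Wilson relation
   between [P] and [Y]. *)
Lemma aw_eliminate (q rho kap e1 e2 : F) (P N Y : 'End(V)) f x :
    q != 0 -> kap != 0 -> q ^+ 2 - q ^- 2 != 0 ->
    rho = - (kap * (q ^+ 2 - q ^- 2)) ->
    (forall f x, kap * (q^-1 * f (Y (P x)) - q * f (P (Y x)))
                 = rho * f (N x) + e1 * f x) ->
    (forall f x, kap * (q^-1 * f (N (Y x)) - q * f (Y (N x)))
                 = rho * f (P x) + e2 * f x) ->
  f (Y (Y (P x))) = (q ^+ 2 + q ^- 2) * f (Y (P (Y x))) - f (P (Y (Y x)))
    - (q ^+ 2 - q ^- 2) ^+ 2 * f (P x)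
    + (q - q^-1) * e1 / kap * f (Y x) + (q ^+ 2 - q ^- 2) * e2 / kap * f x.
Proof.
move=> q0 kap0 K0 rhoE E1 E2.
have rho0 : rho != 0 by rewrite rhoE oppr_eq0 mulf_neq0.
(* The first relation, at the row [f Y] and at the vector [Y x], yields [f(Y N x)] and [f(N Y x)],
   to be substituted into the second. *)
have := E1 (f \o Y)%VF x; have := E1 f (Y x); have := E2 f x.
rewrite !comp_lfunE.
set yyp := f (Y (Y (P x))); set ypy := f (Y (P (Y x))); set pyy := f (P (Y (Y x))).
set p := f (P x); set y := f (Y x); set x' := f x; set ny := f (N (Y x)); set yn := f (Y (N x)).
move: yyp ypy pyy p y x' ny yn => yyp ypy pyy p y x' ny yn.
rewrite /GRing.regular in yyp ypy pyy p y x' ny yn *.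
move=> H1 H2 H3.
have nyE : ny = (kap * (q^-1 * ypy - q * pyy) - e1 * y) / rho.
  by rewrite H2 addrK mulrAC mulfV // mul1r.
have ynE : yn = (kap * (q^-1 * yyp - q * ypy) - e1 * y) / rho.
  by rewrite H3 addrK mulrAC mulfV // mul1r.
move/eqP: H1; rewrite nyE ynE -subr_eq0 => /eqP H.
apply/eqP; rewrite -subr_eq0; apply/eqP.
rewrite -(mulr0 (- rho / kap ^+ 2)) -H rhoE; move: K0 rho0; rewrite rhoE => K0 rho0.
have qq2 : - (kap * ((q * q) ^+ 2 - 1)) != 0.
  have -> : - (kap * ((q * q) ^+ 2 - 1)) = q ^+ 2 * - (kap * (q ^+ 2 - q ^- 2)) by field.
  by rewrite mulf_neq0 // expf_neq0.
by field; rewrite q0 kap0 qq2.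
Qed.

Variables (q : F) (d : nat) (b c bs cs z : F) (A As : 'End(V)).
Hypotheses (q0 : q != 0) (b0 : b != 0) (c0 : c != 0).
Hypothesis (K0 : q ^+ 2 - q ^- 2 != 0).
Hypothesis (Kn0 : q - q^-1 != 0).

Let kap := b * c * (q ^+ 2 - q ^- 2).
Let om := aw_omega q d b c bs cs z.
Let rho := aw_rho q b c.

(** The shift absorbs the [omega] term of each relation; the scale makes [calB u] a multiple of
    [Y - jouk (q u^2)]. *)
Definition aw_dual : 'End(V) :=
  kap^-1 *: (qcomm q As A + (om / (q - q^-1)) *: \1%VF).

Let Y := aw_dual.
Let kap0 : kap != 0. Proof. by rewrite !mulf_neq0. Qed.

Let qq1 : q * q - 1 != 0.
Proof.
by have -> : q * q - 1 = q * (q - q^-1); [field | rewrite mulf_neq0].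
Qed.

Lemma aw_dualE f x :
  f (Y x) = (q * f (As (A x)) - q^-1 * f (A (As x)) + om / (q - q^-1) * f x) / kap.
Proof.
rewrite /Y /aw_dual /qcomm.
rewrite !(scale_lfunE, add_lfunE, opp_lfunE, comp_lfunE, id_lfunE).
rewrite !(linearZ, linearD, linearN) /= !scale_regular mulrC; ring.
Qed.

(** The nested commutator of [A] equals [q^-1 [As,A]_q A - q A [As,A]_q], both expanding to the same
    cubic expression. *)
Lemma aw_relation_A e1 f x :
    qcomm q^-1 A (qcomm q A As) = rho *: As + om *: A + e1 *: \1%VF ->
  kap * (q^-1 * f (Y (A x)) - q * f (A (Y x))) = rho * f (As x) + e1 * f x.
Proof.
move/lfunP => /(_ x) /(congr1 f); rewrite /qcomm => H.
rewrite !(scale_lfunE, add_lfunE, opp_lfunE, comp_lfunE, id_lfunE) in H.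
rewrite !(linearZ, linearD, linearN) /= !scale_regular !invrK in H.
rewrite -[f (A (Y x))]comp_lfunE !aw_dualE !comp_lfunE.
have -> : rho * f (As x) + e1 * f x
    = rho * f (As x) + om * f (A x) + e1 * f x - om * f (A x) by ring.
rewrite -H.
by field; rewrite q0 kap0 qq1.
Qed.

Lemma aw_relation_As e2 f x :
    qcomm q^-1 As (qcomm q As A) = rho *: A + om *: As + e2 *: \1%VF ->
  kap * (q^-1 * f (As (Y x)) - q * f (Y (As x))) = rho * f (A x) + e2 * f x.
Proof.
move/lfunP => /(_ x) /(congr1 f); rewrite /qcomm => H.
rewrite !(scale_lfunE, add_lfunE, opp_lfunE, comp_lfunE, id_lfunE) in H.
rewrite !(linearZ, linearD, linearN) /= !scale_regular !invrK in H.
rewrite -[f (As (Y x))]comp_lfunE !aw_dualE !comp_lfunE.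
have -> : rho * f (A x) + e2 * f x
    = rho * f (A x) + om * f (As x) + e2 * f x - om * f (As x) by ring.
rewrite -H.
by field; rewrite q0 kap0 qq1.
Qed.
End Operators.


(** This difference multiplies the superdiagonal entries in [Y]. One exponential of [theta] cancels,
    leaving a single power of [q] that the index [m] of [calC_minus] compensates. *)
Lemma theta_neighbour_up (F : fieldType) (q b c : F) k : q != 0 ->
  q * theta q b c k.+1 - q^-1 * theta q b c k
  = b * q ^ (2 * k%:Z + 1) * (q ^+ 2 - q ^- 2).
Proof.
move=> q0; rewrite /theta (_ : 2 * k.+1%:Z = 2 * k%:Z + 2%:Z); last by lia.
rewrite -!invr_expz !expfzDr // expr1z -[q ^ 2%:Z]/(q ^+ 2).
have := expfz_neq0 (2 * k%:Z) q0; move: (q ^ _) => X X0.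
by field; rewrite q0 X0.
Qed.

Lemma theta_neighbour_down (F : fieldType) (q b c : F) k : q != 0 ->
  q * theta q b c k - q^-1 * theta q b c k.+1
  = c * (q ^ (2 * k%:Z + 1))^-1 * (q ^+ 2 - q ^- 2).
Proof.
move=> q0; rewrite /theta (_ : 2 * k.+1%:Z = 2 * k%:Z + 2%:Z); last by lia.
rewrite -!invr_expz !expfzDr // expr1z -[q ^ 2%:Z]/(q ^+ 2).
have := expfz_neq0 (2 * k%:Z) q0; move: (q ^ _) => X X0.
by field; rewrite q0 X0.
Qed.

Lemma leonard_coef_tri (F : fieldType) (q : F) d b c bs cs z i j :
  (i.+1 < j)%N -> leonard_coef q d b c bs cs z i j = 0.
Proof.
move=> lt; rewrite /leonard_coef.
have -> : (i == j.+1)%N = false by apply/negbTE; lia.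
have -> : (j == i.+1)%N = false by apply/negbTE; lia.
by have -> : (i == j)%N = false by apply/negbTE; lia.
Qed.

Lemma exprz_shift_minus (F : fieldType) (q : F) (m0 : int) (k : nat) : q != 0 ->
  q ^ (2 - (m0 + 2 * k.+1%:Z)) = (q ^ (m0 - 2) * q ^ (2 * k%:Z + 1) * q)^-1.
Proof.
move=> q0.
transitivity (q ^ (m0 - 2) * q ^ (2 * k%:Z + 1) * q ^ 1)^-1; last by rewrite expr1z.
by rewrite -!expfzDr // invr_expz; congr (q ^ _); clear; lia.
Qed.

Lemma exprz_shift_plus (F : fieldType) (q : F) (m0 : int) (k : nat) : q != 0 ->
  q ^ (m0 + 2 * k.+1%:Z - 2) = (q ^ (- m0 + 2))^-1 * q ^ (2 * k%:Z + 1) * q.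
Proof.
move=> q0.
transitivity ((q ^ (- m0 + 2))^-1 * q ^ (2 * k%:Z + 1) * q ^ 1); last by rewrite expr1z.
by rewrite invr_expz -!expfzDr //; congr (q ^ _); clear; lia.
Qed.

(** * [Y] in the two eigenbases *)

Section DualBasis.
Variables (F : fieldType) (V : vectType F) (q : F) (d : nat) (b c bs cs z : F).
Variables (A As : 'End(V)).
Hypotheses (q0 : q != 0) (b0 : b != 0) (c0 : c != 0) (bs0 : bs != 0).
Hypotheses (cs0 : cs != 0) (z0 : z != 0) (bcE : b * c = bs * cs).
Hypotheses (K0 : q ^+ 2 - q ^- 2 != 0) (Kn0 : q - q^-1 != 0).
Hypothesis hAW : qcomm q^-1 A (qcomm q A As)
  = aw_rho q b c *: As + aw_omega q d b c bs cs z *: A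
    + aw_eta q d b c bs cs z *: \1%VF.
Hypothesis hAWs : qcomm q^-1 As (qcomm q As A)
  = aw_rho q b c *: A + aw_omega q d b c bs cs z *: As
    + aw_eta q d bs cs b c z *: \1%VF.

Let kap := b * c * (q ^+ 2 - q ^- 2).
Let tau := aw_omega q d b c bs cs z / (q - q^-1).
Let Q := q ^+ d.
Let Y := aw_dual q d b c bs cs z A As.
Let kap0 : kap != 0. Proof. by rewrite !mulf_neq0. Qed.
Let Q0 : Q != 0. Proof. by rewrite expf_neq0. Qed.
Let rhoE : aw_rho q b c = - (kap * (q ^+ 2 - q ^- 2)).
Proof. by rewrite /aw_rho /kap; ring. Qed.

Let qq2 : (q * q) ^+ 2 - 1 != 0.
Proof.
have -> : (q * q) ^+ 2 - 1 = q ^+ 2 * (q ^+ 2 - q ^- 2) by field.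
by rewrite !mulf_neq0 ?expf_neq0.
Qed.

Lemma calB_aw_dual chi u :
  calB q d b c bs cs z chi A As u
  = - (chi * bfun (u ^+ 2) / (q ^+ 2 - q ^- 2)) *: (Y - jouk (q * u ^+ 2) *: \1%VF).
Proof.
have E : qcomm q As A + tau *: \1%VF = kap *: Y.
  by rewrite /Y /aw_dual scalerA mulfV // scale1r.
rewrite /calB -/tau E rhoE scalerDr scalerBr !scalerA; congr (_ *: _ + _).
  by field; rewrite q0 qq2 c0 b0 oppr_eq0 mulf_neq0.
rewrite -scaleNr; congr (_ *: _); rewrite /jouk (invfM q (u ^+ 2)); ring.
Qed.

Section Basis.
Variables (ev : nat -> F) (a : nat -> nat -> F) (th : 'I_d.+1 -> V).

(** As [A] is diagonal here, forming [[As, A]_q] only rescales each entry of [As]. *)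
Lemma aw_dual_basis_A (M : 'I_d.+1)
    (yc := fun i j => ((q * ev j - q^-1 * ev i) * a i j + tau * (i == j)%:R) / kap) :
    (forall M : 'I_d.+1, A (th M) = ev M *: th M) ->
    (forall M : 'I_d.+1, As (th M) = \sum_(M' < d.+1) a M' M *: th M') ->
  Y (th M) = \sum_(M' < d.+1) yc M' M *: th M'.
Proof.
move=> A_th As_th; rewrite /Y /aw_dual /qcomm -/kap -/tau.
rewrite !(scale_lfunE, add_lfunE, opp_lfunE, comp_lfunE, id_lfunE).
rewrite A_th [As (_ *: _)]linearZ /= As_th [A (\sum_(_ < _) _)]linear_sum /=.
have -> : tau *: th M = \sum_(M' < d.+1) (tau * (M' == M :> nat)%:R) *: th M'.
  rewrite (bigD1 M) //= eqxx mulr1 big1 ?addr0 // => M' ne.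
  by rewrite (_ : (M' == M :> nat) = false) ?mulr0 ?scale0r //; apply/negbTE.
rewrite !scaler_sumr -sumrB -big_split scaler_sumr; apply: eq_bigr => M' _ /=.
rewrite [A (_ *: _)]linearZ /= A_th !scalerA -scalerBl -scalerDl scalerA; congr (_ *: _).
rewrite /yc; ring.
Qed.

Lemma aw_dual_basis_As (M : 'I_d.+1)
    (yc := fun i j => ((q * ev i - q^-1 * ev j) * a i j + tau * (i == j)%:R) / kap) :
    (forall M : 'I_d.+1, As (th M) = ev M *: th M) ->
    (forall M : 'I_d.+1, A (th M) = \sum_(M' < d.+1) a M' M *: th M') ->
  Y (th M) = \sum_(M' < d.+1) yc M' M *: th M'.
Proof.
move=> As_th A_th; rewrite /Y /aw_dual /qcomm -/kap -/tau.
rewrite !(scale_lfunE, add_lfunE, opp_lfunE, comp_lfunE, id_lfunE).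
rewrite As_th [A (_ *: _)]linearZ /= A_th [As (\sum_(_ < _) _)]linear_sum /=.
have -> : tau *: th M = \sum_(M' < d.+1) (tau * (M' == M :> nat)%:R) *: th M'.
  rewrite (bigD1 M) //= eqxx mulr1 big1 ?addr0 // => M' ne.
  by rewrite (_ : (M' == M :> nat) = false) ?mulr0 ?scale0r //; apply/negbTE.
rewrite !scaler_sumr -sumrB -big_split scaler_sumr; apply: eq_bigr => M' _ /=.
rewrite [As (_ *: _)]linearZ /= As_th !scalerA -scalerBl -scalerDl scalerA; congr (_ *: _).
rewrite /yc; ring.
Qed.

Variables (f : 'Hom(V, F^o)) (x0 : F).
Hypothesis th_basis : basis_of fullv [seq th M | M <- enum 'I_d.+1].
Hypothesis f_th : forall M, f (th M) = (M == ord0)%:R * x0.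
Hypothesis a_tri : forall i j, (i.+1 < j)%N -> a i j = 0.

Lemma row0_sum (g : 'I_d.+1 -> F) : f (\sum_(M < d.+1) g M *: th M) = g ord0 * x0.
Proof.
rewrite linear_sum (bigD1 ord0) //= big1 ?addr0 => [|M /negbTE ne].
  by rewrite linearZ /= f_th eqxx mul1r.
by rewrite linearZ /= f_th ne mul0r scaler0.
Qed.

(** Row 0 of [Y] and row 0 of [B] are supported on the indices 0 and 1, so a multiple of [f B]
    matches the entry at 1 and a multiple of [f] corrects the entry at 0. *)
Lemma row0_aw_dual (e : nat -> F) (B : 'End(V)) x
    (yc := fun j => (e j * a 0 j + tau * (0%N == j)%:R) / kap) :
    (forall M : 'I_d.+1, f (Y (th M)) = yc M * x0) ->
    (forall M : 'I_d.+1, B (th M) = \sum_(M' < d.+1) a M' M *: th M') ->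
  f (Y x) = (e 1%N * f (B x) + (a 0 0 * (e 0%N - e 1%N) + tau) * f x) / kap.
Proof.
move=> Y_th B_th.
suff : (f \o Y)%VF = (e 1%N / kap) *: (f \o B)%VF
    + ((a 0 0 * (e 0%N - e 1%N) + tau) / kap) *: f -> 
  f (Y x) = (e 1%N * f (B x) + (a 0 0 * (e 0%N - e 1%N) + tau) * f x) / kap.
  apply; apply: (hom_eq_on_basis th_basis) => M.
  rewrite [LHS]comp_lfunE Y_th.
  rewrite !(scale_lfunE, add_lfunE, comp_lfunE) !scale_regular B_th row0_sum f_th.
  rewrite /yc eq_sym -[M == ord0]/(M == 0 :> nat).
  case: (val M) => [|[|k]] /=.
  - ring.
  - ring.
  by rewrite a_tri //; ring.
move/lfunP/(_ x); rewrite [LHS]comp_lfunE => ->.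
rewrite !(scale_lfunE, add_lfunE, comp_lfunE) !scale_regular.
ring.
Qed.
End Basis.


(** * Left eigenvectors of [A] *)

Section Minus.
Variables (th : 'I_d.+1 -> V) (bth : 'I_d.+1 -> 'Hom(V, F^o)) (xi : 'I_d.+1 -> F).
Let a := leonard_coef q d b c bs cs z.
Hypothesis hdef : coef_defined q d b c.
Hypothesis th_basis : basis_of fullv [seq th M | M <- enum 'I_d.+1].
Hypothesis A_th : forall M : 'I_d.+1, A (th M) = theta q b c M *: th M.
Hypothesis As_th : forall M : 'I_d.+1, As (th M) = \sum_(M' < d.+1) a M' M *: th M'.
Hypothesis bth_A : forall M : 'I_d.+1, (bth M \o A)%VF = theta q b c M *: bth M.
Hypothesis xi_neq0 : forall M, xi M != 0.
Hypothesis bth_th : forall M' M, bth M' (th M) = (M == M')%:R * xi M.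
Let w := bth ord0.

Let rowA x : w (A x) = theta q b c 0 * w x.
Proof. by rewrite -[w (A x)]comp_lfunE bth_A scale_lfunE. Qed.

Let rowYA x : w (Y (A x)) = theta q b c 1 * w (Y x)
  + aw_shift q b c Q (bs * Q + cs / Q) (z ^+ 2 + z ^- 2) * w x.
Proof.
have f_th M : w (th M) = (M == ord0)%:R * xi ord0.
  by rewrite bth_th; case: eqP => [->|]; rewrite ?mul0r.
pose e j := q * theta q b c j - q^-1 * theta q b c 0.
have R : w (Y x) = (e 1%N * w (As x) + (a 0 0 * (e 0%N - e 1%N) + tau) * w x) / kap.
  apply: (row0_aw_dual th_basis f_th (leonard_coef_tri _ _ _ _ _ _ _)) As_th => M.
  by rewrite (aw_dual_basis_A _ A_th As_th) (row0_sum f_th).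
(* As [w] is a left eigenvector of [A], the relation gives [w Y A] through [w Y], [w As] and [w];
   [R] then leaves only [w As] and [w] to compare. *)
have := aw_relation_A q0 b0 c0 K0 Kn0 w x hAW.
rewrite -/Y -/kap rowA rhoE => E.
have -> : w (Y (A x)) = q ^+ 2 * theta q b c 0 * w (Y x)
    + q * (- (kap * (q ^+ 2 - q ^- 2)) * w (As x) + aw_eta q d b c bs cs z * w x) / kap.
  by rewrite -E; field; rewrite q0 kap0.
rewrite -(aw_shift_minus q0 b0 c0 cs0 z0 bcE K0 hdef) R -/a -/kap -/tau /e theta0 theta1.
by rewrite /kap; field; rewrite b0 q0 qq2 c0.
Qed.

Let rowYYA n x (m := fun x => w (iter n Y x)) :
  m (Y (Y (A x))) = (q ^+ 2 + q ^- 2) * m (Y (A (Y x))) - m (A (Y (Y x)))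
    - (q ^+ 2 - q ^- 2) ^+ 2 * m (A x)
    + aw_lin q b c Q (bs * Q + cs / Q) (b * Q + c / Q) (z ^+ 2 + z ^- 2) * m (Y x)
    + aw_cst q b c Q (bs * Q + cs / Q) (b * Q + c / Q) (z ^+ 2 + z ^- 2) * m x.
Proof.
rewrite aw_eta_lin // aw_eta_cst // /m -!row_powE.
apply: (aw_eliminate (rho := aw_rho q b c) (N := As)) => // g t.
  exact: aw_relation_A.
exact: aw_relation_As.
Qed.

Lemma dual_bethe_minus (chi : F) (m0 : int) (beta : F) (M : 'I_d.+1) (v : 'I_M -> F) :
    irreducible_action A As ->
    injective (fun M : 'I_d.+1 => theta q b c M) -> chi != 0 ->
    (q ^+ 2 - q ^- 2) * chi^-1 * beta * c * q ^ (m0 - 2) = -1 ->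
    bethe_solution q d b c bs cs z (-1) v ->
  bth M = norm_minus q (dual_coef a xi) v *:
    dual_bethe_state w (calC_minus q beta (calB q d b c bs cs z chi A As)) v m0.
Proof.
move=> irr ev_inj chi0 hbeta sol; have [nontriv _ _ _] := sol.
have eig : polylin
    (aw_poly q b c Q (bs * Q + cs / Q) (b * Q + c / Q) (z ^+ 2 + z ^- 2))
    (\prod_(k < M) ('X - (jouk (q * v k ^+ 2))%:P))
  = theta q b c M *: \prod_(k < M) ('X - (jouk (q * v k ^+ 2))%:P).
  apply: (bethe_eigen (e := id) q0 _ _ _ _ sol) => // u u0.
    exact: (Lambda1_minus d q0).
  exact: (Lambda2_minus d q0).
apply: (dual_eigenvector_bethe th_basis A_th ev_inj xi_neq0 bth_th
  (fun M => aw_dual_basis_A M A_th As_th) _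
  (y := fun k => jouk (q * v k ^+ 2)) (n := fun k => q^-1 * v k * bfun (v k ^+ 2))).
- by move=> i j lt; rewrite /a leonard_coef_tri // ltn_eqF ?(ltnW lt) // !mulr0 addr0 mul0r.
- by move=> k; rewrite /calC_minus calB_aw_dual scalerA.
- move=> x; apply: etrans (row_poly_aw (F := F) rowA rowYA rowYYA _ _) _.
  by rewrite eig; apply: row_polyZ.
- move=> k; rewrite (ltn_eqF (ltnSn k)) mulr0 addr0 theta_neighbour_up //.
  rewrite exprz_shift_minus //.
  have qm0 := expfz_neq0 (m0 - 2) q0; have qk0 := expfz_neq0 (2 * k%:Z + 1) q0.
  (* This value of [beta] cancels [chi] and [q ^ (m0 - 2)]; the power [q ^ (2k + 1)] cancels against
     [theta_neighbour_up], leaving the factor of [norm_minus]. *)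
  have -> : beta = - (chi / ((q ^+ 2 - q ^- 2) * c * q ^ (m0 - 2))).
    rewrite -[chi]mulr1 -[1]opprK -hbeta; field.
    by rewrite ?qm0 ?c0 ?q0 ?qq2 ?chi0.
  move: (q ^ (m0 - 2)) (q ^ (2 * k%:Z + 1)) (a k k.+1) (bfun _) qm0 qk0 => X Z a' B X0 Z0.
  rewrite /kap; field.
  by rewrite q0 qq2 c0 b0 Z0 X0 oppr_eq0 mulf_neq0 // expf_neq0.
- move=> k; have [v0 v1] := nontriv k.
  by rewrite !mulf_neq0 ?invr_eq0 // /bfun subr_eq0.
- move=> k; apply: (irreducible_super_neq0 th_basis A_th xi_neq0 bth_th irr As_th).
  exact: leonard_coef_tri.
Qed.

End Minus.

(** * Left eigenvectors of [As] *)

Section Plus.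
Variables (th : 'I_d.+1 -> V) (bth : 'I_d.+1 -> 'Hom(V, F^o)) (xi : 'I_d.+1 -> F).
Let a := leonard_coef q d bs cs b c z^-1.
Hypothesis hdef : coef_defined q d bs cs.
Hypothesis th_basis : basis_of fullv [seq th M | M <- enum 'I_d.+1].
Hypothesis As_th : forall M : 'I_d.+1, As (th M) = theta q bs cs M *: th M.
Hypothesis A_th : forall M : 'I_d.+1, A (th M) = \sum_(M' < d.+1) a M' M *: th M'.
Hypothesis bth_As : forall M : 'I_d.+1, (bth M \o As)%VF = theta q bs cs M *: bth M.
Hypothesis xi_neq0 : forall M, xi M != 0.
Hypothesis bth_th : forall M' M, bth M' (th M) = (M == M')%:R * xi M.
Let w := bth ord0.

Let rowA x : w (As x) = theta q bs cs 0 * w x.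
Proof. by rewrite -[w (As x)]comp_lfunE bth_As scale_lfunE. Qed.

Let rowYA x : w (Y (As x)) = theta q bs cs 1 * w (Y x)
  + aw_shift q bs cs Q (b * Q + c / Q) (z ^+ 2 + z ^- 2) * w x.
Proof.
have f_th M : w (th M) = (M == ord0)%:R * xi ord0.
  by rewrite bth_th; case: eqP => [->|]; rewrite ?mul0r.
pose e j := q * theta q bs cs 0 - q^-1 * theta q bs cs j.
have R : w (Y x) = (e 1%N * w (A x) + (a 0 0 * (e 0%N - e 1%N) + tau) * w x) / kap.
  apply: (row0_aw_dual th_basis f_th (leonard_coef_tri _ _ _ _ _ _ _)) A_th => M.
  by rewrite (aw_dual_basis_As _ As_th A_th) (row0_sum f_th).
have := aw_relation_As q0 b0 c0 K0 Kn0 w x hAWs.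
rewrite -/Y -/kap rowA rhoE => E.
have -> : w (Y (As x)) = q ^- 2 * theta q bs cs 0 * w (Y x)
    - q^-1 * (- (kap * (q ^+ 2 - q ^- 2)) * w (A x) + aw_eta q d bs cs b c z * w x) / kap.
  by rewrite -E; field; rewrite q0 kap0.
rewrite -(aw_shift_plus q0 b0 c0 cs0 z0 bcE K0 hdef) R -/a -/kap -/tau /e theta0 theta1.
have bsE : bs = b * c / cs by rewrite bcE mulfK.
by rewrite /kap bsE; field; rewrite b0 q0 qq2 c0 cs0.
Qed.

Let rowYYA n x (m := fun x => w (iter n Y x)) :
  m (Y (Y (As x))) = (q ^+ 2 + q ^- 2) * m (Y (As (Y x))) - m (As (Y (Y x)))
    - (q ^+ 2 - q ^- 2) ^+ 2 * m (As x)
    + aw_lin q bs cs Q (b * Q + c / Q) (bs * Q + cs / Q) (z ^+ 2 + z ^- 2) * m (Y x)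
    + aw_cst q bs cs Q (b * Q + c / Q) (bs * Q + cs / Q) (z ^+ 2 + z ^- 2) * m x.
Proof.
rewrite aw_eta_lin // aw_eta_cst // -bcE -/kap /m -!row_powE.
(* The relations are exchanged by A <-> A*, q <-> q^-1. *)
have NK : q^-1 ^+ 2 - q^-1 ^- 2 = - (q ^+ 2 - q ^- 2) by rewrite !exprVn !invrK opprB.
have H := @aw_eliminate _ _ q^-1 (aw_rho q b c) (- kap)
  (aw_eta q d bs cs b c z) (aw_eta q d b c bs cs z) As A Y (row_pow Y w n) x.
rewrite H ?invr_eq0 ?NK ?oppr_eq0 //.
- rewrite !exprVn !invrK; field.
  by rewrite q0 oppr_eq0 kap0.
- by rewrite mulrNN rhoE.
- move=> g t; rewrite -(aw_relation_As _ _ _ _ _ _ _ hAWs) // -/Y -/kap invrK; ring.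
- move=> g t; rewrite -(aw_relation_A _ _ _ _ _ _ _ hAW) // -/Y -/kap invrK; ring.
Qed.

Lemma dual_bethe_plus (chi : F) (m0 : int) (beta : F) (N : 'I_d.+1) (y : 'I_N -> F) :
    irreducible_action A As ->
    injective (fun N : 'I_d.+1 => theta q bs cs N) -> chi != 0 ->
    (q ^+ 2 - q ^- 2) * chi^-1 * beta * bs * q ^ (- m0 + 2) = 1 ->
    bethe_solution q d b c bs cs z 1 y ->
  bth N = norm_plus q (dual_coef a xi) y *:
    dual_bethe_state w (calC_plus q beta (calB q d b c bs cs z chi A As)) y m0.
Proof.
move=> irr ev_inj chi0 hbeta sol; have [nontriv _ _ _] := sol.
have eig : polylin
    (aw_poly q bs cs Q (b * Q + c / Q) (bs * Q + cs / Q) (z ^+ 2 + z ^- 2))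
    (\prod_(k < N) ('X - (jouk (q * y k ^+ 2))%:P))
  = theta q bs cs N *: \prod_(k < N) ('X - (jouk (q * y k ^+ 2))%:P).
  (* The common factor of [Lambda1] and [Lambda2] at [eps = 1] is [u^-1], against [u] at
     [eps = -1]. *)
  apply: (bethe_eigen (e := GRing.inv) q0 _ _ _ _ sol) => // u u0.
  - by rewrite invr_eq0.
  - exact: (Lambda1_plus d q0).
  exact: (Lambda2_plus d q0).
have irr' : irreducible_action As A by move=> W WAs WA; apply: irr.
apply: (dual_eigenvector_bethe th_basis As_th ev_inj xi_neq0 bth_th
  (fun M => aw_dual_basis_As M As_th A_th) _
  (y := fun k => jouk (q * y k ^+ 2))
  (n := fun k => - q * (y k)^-1 * bfun (y k ^+ 2))).
- by move=> i j lt; rewrite /a leonard_coef_tri // ltn_eqF ?(ltnW lt) // !mulr0 addr0 mul0r.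
- by move=> k; rewrite /calC_plus calB_aw_dual scalerA.
- move=> x; apply: etrans (row_poly_aw (F := F) rowA rowYA rowYYA _ _) _.
  by rewrite eig; apply: row_polyZ.
- move=> k; rewrite (ltn_eqF (ltnSn k)) mulr0 addr0 theta_neighbour_down //.
  rewrite exprz_shift_plus //.
  have qm0 := expfz_neq0 (- m0 + 2) q0; have qk0 := expfz_neq0 (2 * k%:Z + 1) q0.
  have -> : beta = chi / ((q ^+ 2 - q ^- 2) * bs * q ^ (- m0 + 2)).
    rewrite -[chi in RHS]mulr1 -hbeta; field.
    by rewrite ?qm0 ?bs0 ?q0 ?qq2 ?chi0.
  have [y0 _] := nontriv k.
  move: (q ^ (- m0 + 2)) (q ^ (2 * k%:Z + 1)) (a k k.+1) (bfun _) qm0 qk0 => X Z a' B X0 Z0.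
  have bsE : bs = b * c / cs by rewrite bcE mulfK.
  rewrite /kap bsE; field.
  by rewrite q0 qq2 c0 b0 Z0 X0 cs0 y0 chi0.
- move=> k; have [v0 v1] := nontriv k.
  by rewrite !mulf_neq0 ?oppr_eq0 ?invr_eq0 // /bfun subr_eq0.
- move=> k; apply: (irreducible_super_neq0 th_basis As_th xi_neq0 bth_th irr' A_th).
  exact: leonard_coef_tri.
Qed.

End Plus.
End DualBasis.

(** * Both families of dual eigenvectors over the complex numbers *)

Theorem lemma3p6 (R : realType)
  (q : R[i]) (d : nat) (b c bs cs zeta : R[i])
  (hq0 : q != 0) (hq : forall n : nat, (0 < n)%N -> q ^+ n != 1)
  (hb : b != 0) (hc : c != 0) (hbs : bs != 0) (hcs : cs != 0)
  (hzeta : zeta != 0) (hbc : b * c = bs * cs)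
  (hdef : coef_defined q d b c) (hdefs : coef_defined q d bs cs)
  (* the two operators *)
  (V : vectType R[i]) (hdim : \dim {:V} = d.+1)
  (A As : 'End(V))
  (hirr : irreducible_action A As)
  (hAW : qcomm q^-1 A (qcomm q A As)
         = aw_rho q b c *: As + aw_omega q d b c bs cs zeta *: A
           + aw_eta q d b c bs cs zeta *: \1%VF)
  (hAWs : qcomm q^-1 As (qcomm q As A)
          = aw_rho q b c *: A + aw_omega q d b c bs cs zeta *: As
            + aw_eta q d bs cs b c zeta *: \1%VF)
  (* eigenbases, multiplicity-freeness and tridiagonal actions *)
  (th ths : 'I_d.+1 -> V)
  (hthB : basis_of fullv [seq th M | M <- enum 'I_d.+1])
  (hthsB : basis_of fullv [seq ths N | N <- enum 'I_d.+1])
  (hth : forall M : 'I_d.+1, A (th M) = theta q b c M *: th M)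
  (hths : forall N : 'I_d.+1, As (ths N) = theta q bs cs N *: ths N)
  (hmf : injective (fun M : 'I_d.+1 => theta q b c M))
  (hmfs : injective (fun N : 'I_d.+1 => theta q bs cs N))
  (hAsth : forall M : 'I_d.+1, As (th M) =
     \sum_(M' < d.+1) leonard_coef q d b c bs cs zeta M' M *: th M')
  (hAths : forall N : 'I_d.+1, A (ths N) =
     \sum_(N' < d.+1) leonard_coef q d bs cs b c zeta^-1 N' N *: ths N')
  (hnorm : ths ord0 = \sum_(M < d.+1) th M)
  (* dual eigenvectors *)
  (bth bths : 'I_d.+1 -> 'Hom(V, R[i]^o)) (xi xis : 'I_d.+1 -> R[i])
  (hbth0 : forall M, bth M != 0) (hbths0 : forall N, bths N != 0)
  (hbth : forall M : 'I_d.+1, (bth M \o A)%VF = theta q b c M *: bth M)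
  (hbths : forall N : 'I_d.+1, (bths N \o As)%VF = theta q bs cs N *: bths N)
  (hxi0 : forall M, xi M != 0) (hxis0 : forall N, xis N != 0)
  (hxi : forall M' M, bth M' (th M) = (M == M')%:R * xi M)
  (hxis : forall N' N, bths N' (ths N) = (N == N')%:R * xis N)
  (* parameters of the dual Bethe states *)
  (chi : R[i]) (hchi : chi != 0) (m0 : int) (beta_m beta_p : R[i])
  (hbeta_m : (q ^+ 2 - q ^- 2) * chi^-1 * beta_m * c * q ^ (m0 - 2) = -1)
  (hbeta_p : (q ^+ 2 - q ^- 2) * chi^-1 * beta_p * bs * q ^ (- m0 + 2) = 1)
  (* the assumed solutions of the homogeneous Bethe equations *)
  (v : forall M : 'I_d.+1, 'I_M -> R[i]) (y : forall N : 'I_d.+1, 'I_N -> R[i])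
  (hv : forall M : 'I_d.+1, bethe_solution q d b c bs cs zeta (-1) (v M))
  (hy : forall N : 'I_d.+1, bethe_solution q d b c bs cs zeta 1 (y N)) :
  (forall M : 'I_d.+1,
     bth M =
       norm_minus q (dual_coef (leonard_coef q d b c bs cs zeta) xi) (v M)
       *: dual_bethe_state (bth ord0)
            (calC_minus q beta_m (calB q d b c bs cs zeta chi A As)) (v M) m0)
  /\
  (forall N : 'I_d.+1,
     bths N =
       norm_plus q (dual_coef (leonard_coef q d bs cs b c zeta^-1) xis) (y N)
       *: dual_bethe_state (bths ord0)
            (calC_plus q beta_p (calB q d b c bs cs zeta chi A As)) (y N) m0).
Proof.
have K0 : q ^+ 2 - q ^- 2 != 0.
  rewrite subr_eq0; apply: contra (hq 4 isT) => /eqP E.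
  by rewrite (exprD q 2 2) {1}E mulVf // expf_neq0.
have Kn0 : q - q^-1 != 0.
  rewrite subr_eq0; apply: contra (hq 2 isT) => /eqP E.
  by rewrite expr2 {1}E mulVf.
split=> [M|N].
  exact: (dual_bethe_minus hq0 hb hc hcs hzeta hbc K0 Kn0 hAW hAWs
    hdef hthB hth hAsth hbth hxi0 hxi hirr hmf hchi hbeta_m (hv M)).
exact: (dual_bethe_plus hq0 hb hc hbs hcs hzeta hbc K0 Kn0 hAW hAWs
  hdefs hthsB hths hAths hbths hxis0 hxis hirr hmfs hchi hbeta_p (hy N)).
Qed.
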